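(* For $n$ an odd prime, the non trivial coideal subalgebras of $KD(n)$ are of dimension $2$, $4$, $n$ and $2n$, and the lattice of coideal subalgebras of $KD(n)$ has the following Hasse diagram. There are three coideal subalgebras $I_0,I_1,I_2$ of dimension $2$, $n$ coideal subalgebras $J_0,\dots,J_{n-1}$ of dimension $4$, $n$ coideal subalgebras $K_1,K_{21},\dots,K_{2,n-1}$ of dimension $n$, and three coideal subalgebras $K_2,K_3,K_4$ of dimension $2n$. The minimal non trivial ones are $I_0,I_1,I_2,K_1,K_{21},\dots,K_{2,n-1}$, the maximal proper ones are $J_0,\dots,J_{n-1},K_2,K_3,K_4$, and the inclusions between distinct non trivial proper coideal subalgebras are exactly: $I_0\subset J_k$ for all $k$; $I_1\subset J_0$ and $I_2\subset J_0$; $I_0\subset K_2$, $I_1\subset K_3$, $I_2\subset K_4$; $K_1\subset K_2$, $K_1\subset K_3$, $K_1\subset K_4$; and $K_{2j}\subset K_2$ for $j=1,\dots,n-1$.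
   Context: A coideal subalgebra of a finite-dimensional Kac algebra ($C^*$-Hopf algebra) $K$ is a unital $*$-subalgebra $I$ with $\Delta(I)\subset K\otimes I$; the trivial ones are $\mathbb{C}$ and $K$. $KD(n)$ ($n\ge1$): let $D_{2n}=\langle a,b\mid a^{2n}=b^2=1,\ ba=a^{-1}b\rangle$ (order $4n$), with canonical basis $\lambda(g)$ of $\mathbb{C}[D_{2n}]$, and $\Delta_s(\lambda(g))=\lambda(g)\otimes\lambda(g)$. Put $h_1=1,h_2=a^n,h_3=b,h_4=ba^n$, $\nu=-1+2\mathrm{i}$, and $\Omega=\sum_{i,j}c_{i,j}\lambda(h_i)\otimes\lambda(h_j)$ with $$(c_{i,j})=\frac18\begin{pmatrix}5&1&1&1\\1&1&\bar\nu&\nu\\1&\nu&1&\bar\nu\\1&\bar\nu&\nu&1\end{pmatrix}.$$ $\Omega$ is unitary. $KD(n)$ is the $*$-algebra $\mathbb{C}[D_{2n}]$ with its usual counit and antipode and the coproduct $\Delta(x)=\Omega\Delta_s(x)\Omega^*$. *)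

(* Defs.v *)
From HB Require Import structures.
From mathcomp Require Import all_boot all_order all_algebra.
From mathcomp Require Import all_fingroup all_solvable all_field.
From mathcomp Require Import reals complex.

Set Implicit Arguments.
Unset Strict Implicit.
Unset Printing Implicit Defensive.

Import Order.TTheory GRing.Theory Num.Theory.
Local Open Scope ring_scope.

(* The group algebra C[gT]: functions on gT with the convolution product.     *)
Definition galg (C : fieldType) (gT : finGroupType) : Type :=
  {ffun gT -> C^o}.

Section GroupAlgebra.

Variables (C : fieldType) (gT : finGroupType).
Implicit Types x y z : galg C gT.

HB.instance Definition _ := Vector.copy (galg C gT) {ffun gT -> C^o}.

(* lambda g is the canonical basis vector attached to g. *)
Definition lambda (g : gT) : galg C gT := [ffun h => (h == g)%:R].

Definition galg_mul x y : galg C gT :=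
  [ffun g => \sum_h x h * y (h^-1 * g)%g].

Fact galg_mulA : associative galg_mul.
Proof.
move=> x y z; apply/ffunP=> g; rewrite !ffunE.
transitivity (\sum_h \sum_k x h * (y k * z (k^-1 * (h^-1 * g))%g)).
  by apply: eq_bigr => h _; rewrite ffunE big_distrr.
transitivity (\sum_h \sum_k x h * (y (h^-1 * k)%g * z (k^-1 * g)%g)).
  apply: eq_bigr => h _; rewrite (reindex_inj (mulgI h^-1%g)) /=.
  by apply: eq_bigr => k _; rewrite invMg invgK -mulgA mulKVg.
rewrite exchange_big; apply: eq_bigr => k _; rewrite ffunE big_distrl /=.
by apply: eq_bigr => h _; rewrite mulrA.
Qed.

Fact galg_mul1l : left_id (lambda 1%g) galg_mul.
Proof.
move=> x; apply/ffunP=> g; rewrite ffunE (bigD1 1%g) //= big1 => [|h /negPf nh].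
  by rewrite ffunE eqxx mul1r addr0 invg1 mul1g.
by rewrite ffunE nh mul0r.
Qed.

Fact galg_mul1r : right_id (lambda 1%g) galg_mul.
Proof.
move=> x; apply/ffunP=> g; rewrite ffunE (bigD1 g) //= big1 => [|h /negPf nh].
  by rewrite ffunE mulVg eqxx mulr1 addr0.
by rewrite ffunE -eq_mulVg1 nh mulr0.
Qed.

Fact galg_mulDl : left_distributive galg_mul +%R.
Proof.
move=> x y z; apply/ffunP=> g; rewrite !ffunE -big_split /=.
by apply: eq_bigr => h _; rewrite ffunE mulrDl.
Qed.

Fact galg_mulDr : right_distributive galg_mul +%R.
Proof.
move=> x y z; apply/ffunP=> g; rewrite !ffunE -big_split /=.
by apply: eq_bigr => h _; rewrite ffunE mulrDr.
Qed.

Fact galg_oner_neq0 : lambda 1%g != 0.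
Proof.
by apply/eqP => /ffunP/(_ 1%g) /eqP; rewrite !ffunE eqxx oner_eq0.
Qed.

HB.instance Definition _ := GRing.Zmodule_isNzRing.Build (galg C gT)
  galg_mulA galg_mul1l galg_mul1r galg_mulDl galg_mulDr galg_oner_neq0.

Fact galg_scaleAl (c : C) x y : c *: (x * y) = (c *: x) * y.
Proof.
apply/ffunP=> g; rewrite !ffunE scaler_sumr.
by apply: eq_bigr => h _; rewrite ffunE scalerAl.
Qed.

Fact galg_scaleAr (c : C) x y : c *: (x * y) = x * (c *: y).
Proof.
apply/ffunP=> g; rewrite !ffunE scaler_sumr.
by apply: eq_bigr => h _; rewrite ffunE scalerAr.
Qed.

HB.instance Definition _ :=
  GRing.Lmodule_isLalgebra.Build C (galg C gT) galg_scaleAl.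
HB.instance Definition _ :=
  GRing.Lalgebra_isAlgebra.Build C (galg C gT) galg_scaleAr.
HB.instance Definition _ := Algebra_isFalgebra.Build C (galg C gT).

Lemma lambdaM g h : lambda g * lambda h = lambda (g * h)%g.
Proof.
apply/ffunP=> k; rewrite !ffunE (bigD1 g) //= big1 => [|l /negPf nl].
  by rewrite !ffunE eqxx mul1r addr0 -(inj_eq (mulgI g)) mulKVg.
by rewrite ffunE nl mul0r.
Qed.

Lemma lambda1 : lambda 1%g = 1.
Proof. by []. Qed.

End GroupAlgebra.

(* The involution, that is the antilinear extension of                        *)
(* lambda g |-> lambda g^-1.                                                  *)
Definition gstar (C : numClosedFieldType) (gT : finGroupType)
    (x : galg C gT) : galg C gT :=
  [ffun g => Num.conj (x g^-1%g)].

(* C[gT] \otimes C[hT] is modelled by C[gT * hT], with                        *)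
(* lambda g \otimes lambda h = lambda (g, h); both the product and the        *)
(* involution of C[gT * hT] are those of the tensor product.                  *)
Definition gtens (C : fieldType) (gT hT : finGroupType)
    (x : galg C gT) (y : galg C hT) : galg C (gT * hT)%type :=
  [ffun u => x u.1 * y u.2].

Lemma gtens_lambda (C : fieldType) (gT hT : finGroupType) (g : gT) (h : hT) :
  gtens (lambda C g) (lambda C h) = lambda C (g, h).
Proof. by apply/ffunP=> -[k l]; rewrite !ffunE /= -natrM mulnb. Qed.

Lemma gtensM (C : fieldType) (gT hT : finGroupType)
    (x x' : galg C gT) (y y' : galg C hT) :
  gtens x y * gtens x' y' = gtens (x * x') (y * y').
Proof.
apply/ffunP=> -[g h]; rewrite !ffunE big_distrlr pair_big /=.
by apply: eq_bigr => -[k l] _; rewrite !ffunE mulrACA.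
Qed.

Lemma gstar_gtens (C : numClosedFieldType) (gT hT : finGroupType)
    (x : galg C gT) (y : galg C hT) :
  gstar (gtens x y) = gtens (gstar x) (gstar y).
Proof. by apply/ffunP=> -[g h]; rewrite !ffunE rmorphM. Qed.

Definition tensv (C : fieldType) (gT hT : finGroupType)
    (U : {vspace galg C gT}) (V : {vspace galg C hT}) :
    {vspace galg C (gT * hT)%type} :=
  <<[seq gtens u v | u <- vbasis U, v <- vbasis V]>>%VS.

Section Coideal.

Variables (C : numClosedFieldType) (gT : finGroupType).
Variable Delta : galg C gT -> galg C (gT * gT)%type.

Record coideal_subalgebra (S : {vspace galg C gT}) : Prop := {
  coideal_one : 1 \in S;
  coideal_mul : forall x y, x \in S -> y \in S -> x * y \in S;
  coideal_star : forall x, x \in S -> gstar x \in S;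
  coideal_Delta : forall x, x \in S -> Delta x \in tensv fullv S
}.

Definition nontrivial_coideal (S : {vspace galg C gT}) : Prop :=
  [/\ coideal_subalgebra S, S <> 1%VS & S <> fullv].

Definition minimal_nontrivial_coideal (S : {vspace galg C gT}) : Prop :=
  nontrivial_coideal S /\
  (forall T, nontrivial_coideal T -> (T <= S)%VS -> T = S).

Definition maximal_proper_coideal (S : {vspace galg C gT}) : Prop :=
  [/\ coideal_subalgebra S, S <> fullv &
      forall T, coideal_subalgebra T -> T <> fullv -> (S <= T)%VS -> T = S].

End Coideal.

(* 'D_m is the dihedral group of order m; these relations and the order 4 * n *)
(* of 'D_(4 * n) say that a and b present it as                               *)
(* < a, b | a^(2n) = b^2 = 1, ba = a^-1 b >.                                  *)
Definition dihedral_generators (n : nat) (a b : 'D_(4 * n)) : Prop :=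
  [/\ <<[set a; b]>>%g = [set: 'D_(4 * n)],
      a ^+ (2 * n)%N = 1%g, b ^+ 2 = 1%g & b * a = a^-1 * b]%g.

Lemma dihedral_generators_exist n :
  (0 < n)%N -> exists a b : 'D_(4 * n), dihedral_generators a b.
Proof.
move=> n_gt0; have q_gt1: (1 < 2 * n)%N by rewrite leq_pmulr.
have := isoGrp_hom (Grp_dihedral q_gt1).
have -> : (2 * n).*2 = (4 * n)%N by rewrite -mul2n mulnA.
case/existsP=> -[a b]; rewrite /= !xpair_eqE.
case/and4P=> /eqP gab /eqP an /eqP b2 /eqP ab; exists a, b; split=> //.
  by rewrite -gab joing_idl joing_idr.
have bV: b^-1%g = b by apply/eqP; rewrite eq_invg_mul -expg2 b2.
by rewrite -ab conjgE bV -!mulgA -expg2 b2 mulg1.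
Qed.

Section KD.

Variables (C : numClosedFieldType) (n : nat) (a b : 'D_(4 * n)).

Definition KD_nu : C := -1 + 2 * 'i.

Definition KD_c : 'M[C]_4 :=
  let nu := KD_nu in let nuc := Num.conj KD_nu in
  8^-1 *: \matrix_(i, j) nth 0 (nth [::]
    [:: [:: 5;   1;   1;   1];
        [:: 1;   1; nuc;  nu];
        [:: 1;  nu;   1; nuc];
        [:: 1; nuc;  nu;   1]] i) j.

Definition KD_h (i : 'I_4) : 'D_(4 * n) :=
  nth 1%g [:: 1; a ^+ n; b; b * a ^+ n]%g i.

Definition KD_Omega : galg C ('D_(4 * n) * 'D_(4 * n))%type :=
  \sum_(i < 4) \sum_(j < 4)
     KD_c i j *: gtens (lambda C (KD_h i)) (lambda C (KD_h j)).

Definition Delta_s (x : galg C 'D_(4 * n)) :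
    galg C ('D_(4 * n) * 'D_(4 * n))%type :=
  \sum_g x g *: gtens (lambda C g) (lambda C g).

Definition KD_Delta (x : galg C 'D_(4 * n)) :
    galg C ('D_(4 * n) * 'D_(4 * n))%type :=
  KD_Omega * Delta_s x * gstar KD_Omega.

End KD.

Arguments KD_Omega C {n} a b.
Arguments KD_Delta C {n} a b x.

(* Names of the non trivial coideal subalgebras of KD(n). The index j of NK2_ *)
(* runs over 0, ..., n - 2, so that NK2_ j stands for K_{2, j + 1}.           *)
Inductive KD_node (n : nat) : Type :=
  | NI of 'I_3
  | NJ of 'I_n
  | NK1
  | NK2_ of 'I_n.-1
  | NK2
  | NK3
  | NK4.

Arguments NI {n} _.
Arguments NK1 {n}.
Arguments NK2_ {n} _.
Arguments NK2 {n}.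
Arguments NK3 {n}.
Arguments NK4 {n}.

Section Hasse.

Variable n : nat.
Implicit Types s t : KD_node n.

Definition node_dim s : nat :=
  match s with
  | NI _ => 2
  | NJ _ => 4
  | NK1 | NK2_ _ => n
  | NK2 | NK3 | NK4 => (2 * n)%N
  end.

Definition node_sub s t : bool :=
  match s, t with
  | NI i, NJ k => (i == 0 :> nat) || (k == 0 :> nat)
  | NI i, NK2 => i == 0 :> nat
  | NI i, NK3 => i == 1 :> nat
  | NI i, NK4 => i == 2 :> nat
  | NK1, NK2 | NK1, NK3 | NK1, NK4 => true
  | NK2_ _, NK2 => true
  | _, _ => false
  end.

Definition node_min s : bool :=
  match s with NI _ | NK1 | NK2_ _ => true | _ => false end.

Definition node_max s : bool :=
  match s with NJ _ | NK2 | NK3 | NK4 => true | _ => false end.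

End Hasse.

(* Main.v *)
Require Import Defs.
From HB Require Import structures.
From mathcomp Require Import all_boot all_order all_algebra.
From mathcomp Require Import all_fingroup all_solvable all_field.
From mathcomp Require Import reals complex.
From mathcomp Require Import boolp ring zify.

Set Implicit Arguments.
Unset Strict Implicit.
Unset Printing Implicit Defensive.

Import Order.TTheory GRing.Theory Num.Theory.
Local Open Scope ring_scope.

(** Write z = a^n, c = a^2 and D = <c, b>. Since n is odd, z is a central
    involution outside D and the group is D x <z>.

    The element Omega is a unitary of C[H] \otimes C[H] for the four-group
    H = <z, b>, that is, a function on pairs of characters of H, and there it is
    a 2-cocycle representing the nontrivial class. Up to a coboundary it is
    therefore a bicharacter: with p, q = (1 +- z) / 2 and a suitable unitary v
    of C[H] (the [gauge]),

      Omega = (v \otimes v) (p \otimes 1 + q \otimes b) Delta_s(v)^*,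

    which is [KD_Omega_gauge]. Consequently conjugation by v carries the
    coideal subalgebras for the simpler coproduct

      Delta'(g) = g p \otimes g + g q \otimes b^-1 g b

    onto those of KD(n) ([coideal_conj], [KD_Delta_conj]). As the elements g p
    and g q with g in D form a basis, S is a left coideal for Delta' exactly
    when it is graded by D and stable under the map that sends
    g (s p + t q) to b^-1 g b (t p + s q) ([coideal_graded]).

    A graded *-subalgebra is S = \sum_(g in D) g T_g with T_g inside
    C p + C q = C x C, and T_1 is a unital subalgebra stable under the swap, so
    T_1 is C x C or C. If T_1 = C x C, each T_g is an ideal of C x C, and S is
    determined by the subgroup B of those g with g p in S ([graded_split]). If
    T_1 = C, the inclusion of T_g T_g^* in C forces T_g to be zero or a line
    spanned by some p + chi(g) q with |chi(g)| = 1; the g with T_g nonzero form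
    a subgroup B stable under conjugation by b, on which chi is a character
    with chi(b^-1 g b) = chi(g)^-1 ([graded_char]). For n prime the subgroups
    of D are 1, the n groups <c^k b>, <c> and D. The first case yields I_0, the
    J_k, K_2 and the whole algebra. In the second case <c^k b> is b-stable only
    for k = 0, and the admissible chi are the two signs on <b> (I_1 and I_2),
    the n powers of a faithful character on <c> (K_1 and the K_{2j}), the
    trivial and the sign character on D (K_3 and K_4), and, for B = 1, the
    scalars. Dimensions and inclusions are read off from B and chi. *)

(** * The involution and tensor products of group algebras *)

Section GroupAlgebraTheory.

Variables (C : numClosedFieldType) (gT : finGroupType).
Implicit Types (x y : galg C gT) (g h : gT).

Lemma galg_sum_lambda x : x = \sum_g x g *: lambda C g.
Proof.
apply/ffunP=> h; rewrite sum_ffunE (bigD1 h) //= big1 => [|g /negPf nh].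
  by rewrite !ffunE eqxx addr0 [_ *: _]mulr1.
by rewrite !ffunE eq_sym nh [_ *: _]mulr0.
Qed.

Lemma gstarD x y : gstar (x + y) = gstar x + gstar y.
Proof. by apply/ffunP=> g; rewrite !ffunE rmorphD. Qed.

Lemma gstarZ (c : C) x : gstar (c *: x) = Num.conj c *: gstar x.
Proof. by apply/ffunP=> g; rewrite !ffunE; apply: rmorphM. Qed.

Lemma gstar_lambda g : gstar (lambda C g) = lambda C g^-1.
Proof. by apply/ffunP=> h; rewrite !ffunE conjC_nat eq_invg_sym. Qed.

Lemma gstar0 : gstar (0 : galg C gT) = 0.
Proof. by apply/ffunP=> g; rewrite !ffunE conjC0. Qed.

Lemma gstar1 : gstar (1 : galg C gT) = 1.
Proof. by rewrite -lambda1 gstar_lambda invg1. Qed.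

Lemma gstarK x : gstar (gstar x) = x.
Proof. by apply/ffunP=> g; rewrite !ffunE invgK conjCK. Qed.

Lemma gstar_sum (I : Type) (r : seq I) (P : pred I) (F : I -> galg C gT) :
  gstar (\sum_(i <- r | P i) F i) = \sum_(i <- r | P i) gstar (F i).
Proof. exact: (big_morph (@gstar C gT) gstarD gstar0). Qed.

Lemma gstarM x y : gstar (x * y) = gstar y * gstar x.
Proof.
apply/ffunP=> g; rewrite !ffunE rmorph_sum /=.
rewrite (reindex_inj (mulgI g^-1%g)); apply: eq_bigr => h _ /=.
by rewrite !ffunE rmorphM mulrC !invMg !invgK mulgK.
Qed.

End GroupAlgebraTheory.

Section Tensor.

Variables (C : numClosedFieldType) (gT hT : finGroupType).
Implicit Types (x : galg C gT) (y : galg C hT) (w : galg C (gT * hT)%type).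

Lemma gtensDl x x' y : gtens (x + x') y = gtens x y + gtens x' y.
Proof. by apply/ffunP=> -[g h]; rewrite !ffunE mulrDl. Qed.

Lemma gtensDr x y y' : gtens x (y + y') = gtens x y + gtens x y'.
Proof. by apply/ffunP=> -[g h]; rewrite !ffunE mulrDr. Qed.

Lemma gtensZl (c : C) x y : gtens (c *: x) y = c *: gtens x y.
Proof. by apply/ffunP=> -[g h]; rewrite !ffunE [RHS]mulrA. Qed.

Lemma gtensZr (c : C) x y : gtens x (c *: y) = c *: gtens x y.
Proof. by apply/ffunP=> -[g h]; rewrite !ffunE [RHS]mulrCA. Qed.

Lemma gtens0r x : gtens x (0 : galg C hT) = 0.
Proof. by apply/ffunP=> -[g h]; rewrite !ffunE mulr0. Qed.

Lemma gtens0l y : gtens (0 : galg C gT) y = 0.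
Proof. by apply/ffunP=> -[g h]; rewrite !ffunE mul0r. Qed.

Lemma gtens_sumr x (I : Type) (r : seq I) (P : pred I) (F : I -> galg C hT) :
  gtens x (\sum_(i <- r | P i) F i) = \sum_(i <- r | P i) gtens x (F i).
Proof.
exact: (big_morph (gtens x) (gtensDr x) (gtens0r x)).
Qed.

Lemma gtens_suml (I : Type) (r : seq I) (P : pred I) (F : I -> galg C gT) y :
  gtens (\sum_(i <- r | P i) F i) y = \sum_(i <- r | P i) gtens (F i) y.
Proof.
elim/big_rec2: _ => [|i u v _ <-]; first exact: gtens0l.
by rewrite gtensDl.
Qed.

Lemma gtens11 : gtens 1 1 = 1 :> galg C (gT * hT)%type.
Proof. by rewrite -!lambda1 gtens_lambda. Qed.

Definition slice (g : gT) w : galg C hT := [ffun h => w (g, h)].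

Fact slice_is_linear g : linear (slice g).
Proof. by move=> c u v; apply/ffunP=> h; rewrite !ffunE. Qed.
HB.instance Definition _ g :=
  GRing.isLinear.Build C _ _ _ (slice g) (slice_is_linear g).

Lemma slice_gtens g x y : slice g (gtens x y) = x g *: y.
Proof. by apply/ffunP=> h; rewrite !ffunE. Qed.

Lemma sum_slice w : w = \sum_g gtens (lambda C g) (slice g w).
Proof.
apply/ffunP=> -[g h]; rewrite sum_ffunE (bigD1 g) //= big1 => [|k /negPf nk].
  by rewrite !ffunE eqxx addr0 mul1r.
by rewrite !ffunE eq_sym nk mul0r.
Qed.

Lemma gtens_tensv x y (U : {vspace galg C gT}) (V : {vspace galg C hT}) :
  x \in U -> y \in V -> gtens x y \in tensv U V.
Proof.
move=> /coord_vbasis-> /coord_vbasis->; rewrite gtens_suml.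
apply: memv_suml => i _; rewrite gtens_sumr; apply: memv_suml => j _.
rewrite gtensZl gtensZr; do 2!apply: memvZ; apply/memv_span/allpairsP.
by exists ((vbasis U)`_i, (vbasis V)`_j); split; rewrite ?mem_nth ?size_tuple.
Qed.

(** As the first factor is everything, w can be expanded along the basis of that
    factor, one coefficient at a time. This turns the coideal condition into
    closure conditions on S. *)
Lemma tensv_slice w (S : {vspace galg C hT}) :
  w \in tensv fullv S <-> forall g, slice g w \in S.
Proof.
split=> [wS g | wS].
  suff: (tensv fullv S <= linfun (slice g) @^-1: S)%VS.
    by move/subvP/(_ w wS); rewrite -memv_preim lfunE.
  apply/span_subvP=> _ /allpairsP[[u v] /= [_ vS ->]].
  by rewrite -memv_preim lfunE /= slice_gtens memvZ ?vbasis_mem.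
rewrite [w]sum_slice; apply: memv_suml => g _.
by apply: gtens_tensv; rewrite ?memvf.
Qed.

End Tensor.

(** * Transport of coideal subalgebras by a unitary *)

Section Conjugation.

Variables (C : numClosedFieldType) (gT : finGroupType) (v : galg C gT).
Hypotheses (vvs : v * gstar v = 1) (vsv : gstar v * v = 1).

Definition conjv (x : galg C gT) : galg C gT := v * x * gstar v.

Fact conjv_is_linear : linear conjv.
Proof.
by move=> c x y; rewrite /conjv mulrDr mulrDl -scalerAr -scalerAl.
Qed.
HB.instance Definition _ := GRing.isLinear.Build C _ _ _ conjv conjv_is_linear.

Lemma conjvM x y : conjv (x * y) = conjv x * conjv y.
Proof. by rewrite /conjv !mulrA -(mulrA _ (gstar v) v) vsv mulr1. Qed.

Lemma conjv1 : conjv 1 = 1.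
Proof. by rewrite /conjv mulr1. Qed.

Lemma conjv_star x : conjv (gstar x) = gstar (conjv x).
Proof. by rewrite /conjv !gstarM gstarK mulrA. Qed.

Lemma conjv_inj : injective conjv.
Proof.
move=> x y /(congr1 (fun t => gstar v * t * v)); rewrite /conjv !mulrA vsv.
by rewrite !mul1r -!mulrA vsv !mulr1.
Qed.

Lemma lker_conjv : lker (linfun conjv) == 0%VS.
Proof. by apply/lker0P => x y; rewrite !lfunE => /conjv_inj. Qed.

Lemma memv_conjv x (S : {vspace galg C gT}) :
  (conjv x \in linfun conjv @: S)%VS = (x \in S).
Proof.
apply/idP/idP=> [/memv_imgP[y yS]|xS].
  by rewrite lfunE => /conjv_inj ->.
by rewrite -(lfunE conjv) memv_img.
Qed.

Lemma conjv_img_full : (linfun conjv @: fullv)%VS = fullv.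
Proof. exact: lker0_limgf lker_conjv. Qed.

Lemma conjv_surj y : exists x, y = conjv x.
Proof.
have: y \in (linfun conjv @: fullv)%VS by rewrite conjv_img_full memvf.
by case/memv_imgP=> x _ ->; exists x; rewrite lfunE.
Qed.

Lemma conjv_img1 : (linfun conjv @: 1)%VS = 1%VS.
Proof. by rewrite limg_line lfunE /= conjv1. Qed.

Lemma conjv_img_inj : injective (fun S => (linfun conjv @: S)%VS).
Proof.
by move=> S T ST; apply/vspaceP=> x; rewrite -memv_conjv ST memv_conjv.
Qed.

Lemma conjv_img_surj T : exists S, T = (linfun conjv @: S)%VS.
Proof.
exists (linfun conjv @^-1: T)%VS; apply/vspaceP=> y.
have [x ->] := conjv_surj y.
by rewrite memv_conjv -memv_preim lfunE.
Qed.

Variables D D' : galg C gT -> galg C (gT * gT)%type.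
Hypothesis DD' : forall x,
  D (conjv x) = gtens v v * D' x * gstar (gtens v v).

(** Conjugation by v \otimes v preserves the left factor, which is everything,
    and acts as conjugation by v on the right one; the converse is the same
    statement for the inverse of v. *)
Lemma tensv_conj w S :
  gtens v v * w * gstar (gtens v v) \in tensv fullv (linfun conjv @: S)%VS
    <-> w \in tensv fullv S.
Proof.
have sub (u u' : galg C gT) w' (S1 S2 : {vspace galg C gT}) :
    (forall x, x \in S1 -> u * x * u' \in S2) ->
    w' \in tensv fullv S1 ->
    gtens u u * w' * gtens u' u' \in tensv fullv S2.
  move=> uS /tensv_slice w'S; rewrite [w']sum_slice mulr_sumr mulr_suml.
  apply: memv_suml => g _; rewrite !gtensM.
  by apply: gtens_tensv; rewrite ?memvf ?uS.
rewrite gstar_gtens; split=> [|wS]; last first.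
  by apply: (sub _ _ _ S) wS => x xS; rewrite memv_conjv.
move/(sub (gstar v) v _ _ S).
rewrite !mulrA gtensM vsv gtens11 mul1r -mulrA gtensM vsv gtens11 mulr1.
apply=> y; have [x ->] := conjv_surj y; rewrite memv_conjv /conjv !mulrA vsv.
by rewrite mul1r -mulrA vsv mulr1.
Qed.

(** Conjugation by a unitary is a *-automorphism, so two coproducts that it
    intertwines have the same coideal subalgebras up to conjugation. *)
Lemma coideal_conj S :
  coideal_subalgebra D (linfun conjv @: S)%VS <-> coideal_subalgebra D' S.
Proof.
split=> -[S1 SM Ss SD]; split.
- by rewrite -memv_conjv conjv1.
- by move=> x y xS yS; rewrite -memv_conjv conjvM SM ?memv_conjv.
- by move=> x xS; rewrite -memv_conjv conjv_star Ss ?memv_conjv.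
- by move=> x xS; apply/tensv_conj; rewrite -DD' SD ?memv_conjv.
- by rewrite -conjv1 memv_conjv.
- move=> x' y'; have [x ->] := conjv_surj x'; have [y ->] := conjv_surj y'.
  by rewrite -conjvM !memv_conjv; apply: SM.
- move=> x'; have [x ->] := conjv_surj x'.
  by rewrite -conjv_star !memv_conjv; apply: Ss.
- move=> x'; have [x ->] := conjv_surj x'; rewrite memv_conjv DD' => xS.
  by apply/tensv_conj/SD.
Qed.

End Conjugation.

(** * Spans of families *)

Section SpanLemmas.
Variables (K : fieldType) (vT : vectType K).

Lemma span_linear0 (X : seq vT) (f : {linear vT -> K^o}) x :
  {in X, forall u, f u = 0} -> x \in <<X>>%VS -> f x = 0.
Proof.
move=> fX; suff /subvP le : (<<X>> <= lker (linfun f))%VS.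
  by move/le; rewrite memv_ker lfunE => /eqP.
by apply/span_subvP => u uX; rewrite memv_ker lfunE /= fX.
Qed.

(** A family with a dual family of functionals is free. *)
Lemma dim_span_dual (I : finType) (B : {set I}) (v : I -> vT)
    (phi : I -> {linear vT -> K^o}) :
  {in B &, forall i j, phi i (v j) = (i == j)%:R} ->
  \dim <<[seq v i | i in B]>> = #|B|.
Proof.
move=> phi_v.
have -> : <<[seq v i | i in B]>>%VS = (\sum_(i in B) <[v i]>)%VS.
  by rewrite span_def big_map big_enum.
have dv : directv (\sum_(i in B) <[v i]>).
  apply/directv_sum_independent => us us_v sum0 i iB.
  have := congr1 (phi i) sum0; rewrite linear_sum linear0 (bigD1 i) //= big1.
    rewrite addr0; have /vlineP[k ->] := us_v i iB.
    by rewrite linearZ /= phi_v // eqxx [_ *: _]mulr1 => ->; rewrite scale0r.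
  move=> j /andP[jB /negPf ji]; have /vlineP[k ->] := us_v j jB.
  by rewrite linearZ /= phi_v // eq_sym ji [_ *: _]mulr0.
rewrite (directvP dv) /= -sum1_card; apply: eq_bigr => i iB; rewrite dim_vline.
case: eqP => // vi0; have := phi_v i i iB iB; rewrite vi0 eqxx linear0.
by move/eqP; rewrite eq_sym oner_eq0.
Qed.

End SpanLemmas.

Section SpanAlgebra.
Variables (C : numClosedFieldType) (gT : finGroupType).
Implicit Types (X : seq (galg C gT)).

Lemma span_mul X x y :
  {in X &, forall u v, u * v \in <<X>>%VS} ->
  x \in <<X>>%VS -> y \in <<X>>%VS -> x * y \in <<X>>%VS.
Proof.
move=> XM; rewrite -[X]/(tval (in_tuple X)).
move=> /coord_span -> /coord_span ->; rewrite mulr_suml memv_suml // => i _.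
rewrite mulr_sumr memv_suml // => j _; rewrite -scalerAl -scalerAr.
by do 2!apply: memvZ; apply: XM; apply: mem_nth.
Qed.

Lemma span_star X x :
  {in X, forall u, gstar u \in <<X>>%VS} ->
  x \in <<X>>%VS -> gstar x \in <<X>>%VS.
Proof.
move=> Xs; rewrite -[X]/(tval (in_tuple X)) => /coord_span ->.
rewrite gstar_sum memv_suml // => i _; rewrite gstarZ.
by apply: memvZ; apply: Xs; apply: mem_nth.
Qed.

End SpanAlgebra.

(** * The coproduct twisted by a bicharacter *)

Section Diagonal.
Variables (C : numClosedFieldType) (gT : finGroupType).
Implicit Types x y : galg C gT.

(** The cocommutative coproduct of a group algebra, as an algebra morphism into
    the group algebra of the square. *)
Definition diagD x : galg C (gT * gT)%type :=
  \sum_g x g *: gtens (lambda C g) (lambda C g).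

Lemma diagE x u : diagD x u = (u.1 == u.2)%:R * x u.1.
Proof.
rewrite /diagD sum_ffunE (bigD1 u.1) //= big1 => [|g /negPf ng].
  by rewrite !ffunE eqxx addr0 mul1r eq_sym mulrC.
by rewrite !ffunE eq_sym ng mul0r [_ *: _]mulr0.
Qed.

Fact diag_is_linear : linear diagD.
Proof.
move=> c x y; apply/ffunP=> u; rewrite !(diagE, ffunE) mulrDr.
by congr (_ + _); rewrite [LHS]mulrCA.
Qed.
HB.instance Definition _ := GRing.isLinear.Build C _ _ _ diagD diag_is_linear.

Lemma diag_lambda g : diagD (lambda C g) = lambda C (g, g).
Proof.
rewrite /diagD (bigD1 g) //= big1 => [|h /negPf ng].
  by rewrite ffunE eqxx scale1r addr0 gtens_lambda.
by rewrite ffunE ng scale0r.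
Qed.

Lemma diagM x y : diagD (x * y) = diagD x * diagD y.
Proof.
rewrite {1}[x]galg_sum_lambda {1}[y]galg_sum_lambda mulr_suml linear_sum /=.
rewrite [diagD x in RHS]/diagD mulr_suml; apply: eq_bigr => g _.
rewrite mulr_sumr linear_sum [diagD y in RHS]/diagD mulr_sumr /=.
apply: eq_bigr => h _; rewrite -!scalerAl -!scalerAr !linearZ /=.
by rewrite lambdaM diag_lambda !gtens_lambda lambdaM [RHS]scalerA mulrC -scalerA.
Qed.

Lemma diag1 : diagD 1 = 1.
Proof. by rewrite -lambda1 diag_lambda. Qed.

Lemma diag_star x : gstar (diagD x) = diagD (gstar x).
Proof.
apply/ffunP=> -[g h]; rewrite ffunE !diagE !ffunE rmorphM /= conjC_nat.
by rewrite (inj_eq invg_inj).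
Qed.

End Diagonal.

Lemma idem_combM (K : comPzRingType) (A : algType K) (p q : A) (s t s' t' : K) :
  p * p = p -> q * q = q -> p * q = 0 -> q * p = 0 ->
  (s *: p + t *: q) * (s' *: p + t' *: q) = (s * s') *: p + (t * t') *: q.
Proof.
move=> pp qq pq qp; rewrite mulrDl !mulrDr -!scalerAl -!scalerAr pp qq pq qp.
by rewrite !scaler0 addr0 add0r !scalerA.
Qed.

Section Twist.

Variables (C : numClosedFieldType) (gT : finGroupType) (z b : gT).
Hypotheses (zC : forall g, commute z g) (z2 : (z * z = 1)%g).
Hypotheses (z_neq1 : z != 1%g) (b2 : (b * b = 1)%g).
Implicit Types (x y : galg C gT) (g h : gT) (S : {vspace galg C gT}).

(** The minimal idempotents of C[<z>]: as z is central, they split the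
    algebra into the two ideals that they generate. *)
Definition zpos : galg C gT := 2^-1 *: (1 + lambda C z).
Definition zneg : galg C gT := 2^-1 *: (1 - lambda C z).

Let half2 : 2^-1 + 2^-1 = 1 :> C.
Proof. by field. Qed.

Lemma zposDzneg : zpos + zneg = 1.
Proof.
by rewrite -scalerDr addrACA subrr addr0 scalerDr -scalerDl half2 scale1r.
Qed.

Let lz2 : lambda C z * lambda C z = 1.
Proof. by rewrite lambdaM z2. Qed.

Lemma lambda_zpos : lambda C z * zpos = zpos.
Proof. by rewrite -scalerAr mulrDr lz2 mulr1 addrC. Qed.

Lemma lambda_zneg : lambda C z * zneg = - zneg.
Proof. by rewrite -scalerAr mulrBr lz2 mulr1 -scalerN opprB. Qed.

Lemma zpos_mul x : lambda C z * x = x -> zpos * x = x.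
Proof. by move=> zx; rewrite -scalerAl mulrDl zx mul1r scalerDr -scalerDl half2 scale1r. Qed.

Lemma zpos_idem : zpos * zpos = zpos.
Proof. exact: zpos_mul lambda_zpos. Qed.

Lemma zpos_zneg : zpos * zneg = 0.
Proof. by rewrite -scalerAl mulrDl lambda_zneg mul1r subrr scaler0. Qed.

Lemma zneg_idem : zneg * zneg = zneg.
Proof. by rewrite -[X in X * _](addKr zpos) zposDzneg mulrDl mulNr zpos_zneg oppr0 add0r mul1r. Qed.

Lemma lambda_central x : lambda C z * x = x * lambda C z.
Proof.
rewrite [x]galg_sum_lambda mulr_sumr mulr_suml; apply: eq_bigr => g _.
by rewrite -scalerAl -scalerAr !lambdaM zC.
Qed.

Lemma zpos_central x : zpos * x = x * zpos.
Proof. by rewrite -scalerAl -scalerAr mulrDl mulrDr lambda_central mul1r mulr1. Qed.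

Lemma zneg_central x : zneg * x = x * zneg.
Proof. by rewrite -scalerAl -scalerAr mulrBl mulrBr lambda_central mul1r mulr1. Qed.

Lemma zneg_zpos : zneg * zpos = 0.
Proof. by rewrite zneg_central zpos_zneg. Qed.

Lemma gstar_zpos : gstar zpos = zpos.
Proof.
rewrite gstarZ gstarD gstar1 gstar_lambda.
have -> : (z^-1 = z)%g by apply/eqP; rewrite eq_invg_mul z2.
by rewrite fmorphV /= conjC_nat.
Qed.

Lemma gstar_zneg : gstar zneg = zneg.
Proof.
have <- : 1 - zpos = zneg by rewrite -zposDzneg addrC addKr.
by rewrite -scaleN1r gstarD gstarZ gstar1 gstar_zpos rmorphN1.
Qed.

(** The algebra is graded by the group modulo z, and [helt g s t] is the general
    element of the degree of g, in the coordinates that identify C[<z>] with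
    C x C, where products and adjoints are computed componentwise. *)
Definition helt g (s t : C) : galg C gT := lambda C g * (s *: zpos + t *: zneg).

Lemma heltM g h s t s' t' :
  helt g s t * helt h s' t' = helt (g * h)%g (s * s') (t * t').
Proof.
have central x : (s *: zpos + t *: zneg) * x = x * (s *: zpos + t *: zneg).
  rewrite mulrDl mulrDr -(scalerAl s) -(scalerAl t) -(scalerAr s).
  by rewrite -(scalerAr t) zpos_central zneg_central.
rewrite /helt mulrA -(mulrA (lambda C g)) central mulrA lambdaM -mulrA.
by rewrite (idem_combM _ _ _ _ zpos_idem zneg_idem zpos_zneg zneg_zpos).
Qed.

Lemma helt_star g s t : gstar (helt g s t) = helt g^-1 (Num.conj s) (Num.conj t).
Proof.
rewrite /helt gstarM gstarD (gstarZ s) (gstarZ t) gstar_zpos gstar_zneg gstar_lambda.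
rewrite mulrDl mulrDr -!(scalerAl (Num.conj _)) -!(scalerAr (Num.conj _)).
by rewrite zpos_central zneg_central.
Qed.

Lemma helt11 : helt 1 1 1 = 1.
Proof. by rewrite /helt !scale1r zposDzneg mulr1. Qed.

Lemma heltD g s t s' t' : helt g s t + helt g s' t' = helt g (s + s') (t + t').
Proof. by rewrite /helt -mulrDr !scalerDl addrACA. Qed.

Lemma heltZ g c s t : c *: helt g s t = helt g (c * s) (c * t).
Proof. by rewrite /helt scalerAr scalerDr !scalerA. Qed.

Lemma helt00 g : helt g 0 0 = 0.
Proof. by rewrite /helt !scale0r addr0 mulr0. Qed.

Lemma helt_z g s t : helt (g * z)%g s t = helt g s (- t).
Proof.
rewrite /helt -lambdaM -mulrA mulrDr -(scalerAr s) -(scalerAr t) lambda_zpos.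
by rewrite lambda_zneg scalerN scaleNr.
Qed.

Lemma heltE g s t :
  helt g s t =
  ((s + t) / 2) *: lambda C g + ((s - t) / 2) *: lambda C (g * z)%g.
Proof.
rewrite /helt /zpos /zneg mulrDr -!scalerAr !(mulrDr, mulrN, mulr1) lambdaM.
by rewrite !scalerA !scalerDr addrACA -scalerDl -mulrDl scalerN -scaleNr -scalerDl -mulrBl.
Qed.

(** The coordinates of the component of x in the degree of g, relative to the
    representative g of its class modulo z; replacing g by g z changes the sign
    of the second one. *)
Definition pos_coef g x : C := x g + x (g * z)%g.
Definition neg_coef g x : C := x g - x (g * z)%g.

Fact pos_coef_is_linear g : linear (pos_coef g : galg C gT -> C^o).
Proof. by move=> k x y; rewrite /pos_coef !ffunE scalerDr addrACA. Qed.
HB.instance Definition _ g :=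
  GRing.isLinear.Build C (galg C gT) C^o _ (pos_coef g) (pos_coef_is_linear g).

Fact neg_coef_is_linear g : linear (neg_coef g : galg C gT -> C^o).
Proof. by move=> k x y; rewrite /neg_coef !ffunE scalerBr opprD addrACA. Qed.
HB.instance Definition _ g :=
  GRing.isLinear.Build C (galg C gT) C^o _ (neg_coef g) (neg_coef_is_linear g).

Lemma lambda_neqz g : (g == g * z)%g = false.
Proof. by rewrite -{1}(mulg1 g) (inj_eq (mulgI g)) eq_sym (negPf z_neq1). Qed.

Lemma heltE1 g s t : helt g s t g = (s + t) / 2.
Proof. by rewrite heltE !ffunE eqxx lambda_neqz [_ *: _]mulr1 [_ *: _]mulr0 addr0. Qed.

Lemma heltE2 g s t : helt g s t (g * z)%g = (s - t) / 2.
Proof. by rewrite heltE !ffunE eqxx eq_sym lambda_neqz [_ *: 1]mulr1 [_ *: _]mulr0 add0r. Qed.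

Lemma pos_coef_helt g s t : pos_coef g (helt g s t) = s.
Proof. by rewrite /pos_coef heltE1 heltE2; field. Qed.

Lemma neg_coef_helt g s t : neg_coef g (helt g s t) = t.
Proof. by rewrite /neg_coef heltE1 heltE2; field. Qed.

(** As a function of two characters u, v of the four-group <z, b> this is the
    bicharacter equal to -1 when u(z) = v(b) = -1, and to 1 otherwise. *)
Definition twist : galg C (gT * gT)%type :=
  gtens zpos 1 + gtens zneg (lambda C b).

Definition twistedD x := twist * diagD x * twist.

Lemma gstar_twist : gstar twist = twist.
Proof.
rewrite gstarD !gstar_gtens gstar_zpos gstar_zneg gstar1 gstar_lambda.
by have -> : (b^-1 = b)%g by apply/eqP; rewrite eq_invg_mul b2.
Qed.

Let bV : (b^-1 = b)%g. Proof. by apply/eqP; rewrite eq_invg_mul b2. Qed.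

(** The two idempotents are central and orthogonal, so the cross terms vanish
    and b only acts, by conjugation, on the second leg of the negative part. *)
Lemma twistedD_lambda g :
  twistedD (lambda C g) = gtens (helt g 1 0) (lambda C g)
                      + gtens (helt g 0 1) (lambda C (g ^ b)%g).
Proof.
rewrite /twistedD diag_lambda -gtens_lambda !mulrDl !mulrDr !gtensM.
rewrite zpos_central zneg_central -!mulrA zpos_idem zneg_idem zneg_zpos zpos_zneg.
rewrite mulr0 !gtens0l addr0 add0r !mulr1 !mul1r !lambdaM /helt conjgE bV mulgA.
by rewrite !scale1r !scale0r addr0 add0r.
Qed.

(** Only g = k and g = k z contribute, since g p and g q are supported on
    the class of g modulo z. *)
Lemma slice_twistedD x k :
  slice k (twistedD x) = 2^-1 *: (helt k (pos_coef k x) (neg_coef k x)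
     + helt (k ^ b)%g (neg_coef k x) (pos_coef k x)).
Proof.
have -> : twistedD x = \sum_g x g *: twistedD (lambda C g).
  rewrite {1}[x]galg_sum_lambda /twistedD linear_sum mulr_sumr mulr_suml /=.
  by apply: eq_bigr => g _; rewrite linearZ /= -scalerAr -scalerAl.
rewrite linear_sum /=.
pose F g := x g *: slice k (twistedD (lambda C g)).
rewrite (eq_bigr F) => [|g _]; last by rewrite linearZ.
rewrite (bigD1 k) //= (bigD1 (k * z)%g) /=; last by rewrite eq_sym lambda_neqz.
rewrite addrA big1 ?addr0 => [|g /andP[/negPf gk /negPf gkz]]; last first.
  rewrite /F twistedD_lambda linearD /= !slice_gtens !heltE !ffunE.
  by rewrite eq_sym gk -(inj_eq (mulIg z)) -mulgA z2 mulg1 eq_sym gkz /=;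
    rewrite ![_ *: 0]mulr0 addr0 !scale0r addr0 scaler0.
have zb : ((k * z) ^ b = k ^ b * z)%g by rewrite conjMg (conjgE z) zC mulKg.
rewrite /F !twistedD_lambda !linearD /= !slice_gtens !helt_z !heltE1 zb !heltE.
rewrite /pos_coef /neg_coef; move: (x k) (x _) => s t.
move: (lambda C k) (lambda C _) (lambda C (_ ^ b)%g) (lambda C _) => e1 e2 e3 e4.
apply/ffunP=> h; rewrite !ffunE; move: (e1 h) (e2 h) (e3 h) (e4 h).
by move=> {e1 e2 e3 e4} e1 e2 e3 e4; rewrite /GRing.scale /=; field.
Qed.

Lemma slice_twistedDz x k :
  slice (k * z)%g (twistedD x) = 2^-1 *: (helt k (pos_coef k x) (neg_coef k x)
     - helt (k ^ b)%g (neg_coef k x) (pos_coef k x)).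
Proof.
have zb : ((k * z) ^ b = k ^ b * z)%g by rewrite conjMg (conjgE z) zC mulKg.
have pz : pos_coef (k * z)%g x = pos_coef k x by rewrite /pos_coef -mulgA z2 mulg1 addrC.
have nz : neg_coef (k * z)%g x = - neg_coef k x by rewrite /neg_coef -mulgA z2 mulg1 opprB.
rewrite slice_twistedD zb !helt_z pz nz opprK; congr (_ *: (_ + _)).
by rewrite -[RHS]scaleN1r heltZ !mulN1r.
Qed.

(** The last two fields say that S is spanned by its homogeneous elements and is
    stable under the automorphism that conjugates by b and exchanges the two
    idempotents of C[<z>]. *)
Record graded_subalgebra S : Prop := {
  graded_one : 1 \in S;
  graded_mul : forall x y, x \in S -> y \in S -> x * y \in S;
  graded_star : forall x, x \in S -> gstar x \in S;
  graded_comp : forall x g, x \in S -> helt g (pos_coef g x) (neg_coef g x) \in S;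
  graded_swap : forall g s t, helt g s t \in S -> helt (g ^ b)%g t s \in S
}.

(** The slices at k and k z are half the sum and half the difference of the
    component of x in the degree of k and of its image under the swap, so both
    slices lie in S exactly when these two elements do. *)
Lemma coideal_graded S : coideal_subalgebra twistedD S <-> graded_subalgebra S.
Proof.
split=> [[S1 SM Ss SD] | [S1 SM Ss Sc Sw]]; last first.
  split=> [//|//|//|x xS]; apply/tensv_slice => k; rewrite slice_twistedD.
  by apply/memvZ/memvD; [apply: Sc | apply/Sw/Sc].
have slS x k : x \in S -> slice k (twistedD x) \in S.
  by move=> xS; apply: (iffLR (tensv_slice _ _)); apply: SD.
split=> [//|//|//|x g xS|g s t gS].
  have := memvD (slS _ g xS) (slS _ (g * z)%g xS).
  rewrite slice_twistedD slice_twistedDz -scalerDr addrACA subrr addr0 scalerDr.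
  by rewrite -scalerDl half2 scale1r.
have := memvB (slS _ g gS) (slS _ (g * z)%g gS).
rewrite slice_twistedD slice_twistedDz pos_coef_helt neg_coef_helt -scalerBr opprB.
by rewrite addrC addrA subrK scalerDr -scalerDl half2 scale1r.
Qed.

(** * Classification of the graded subalgebras *)

Variable D : {group gT}.
Hypotheses (Dz : forall g, ((g * z)%g \in D) = (g \notin D)) (Db : b \in D).
Implicit Types (B : {group gT}) (chi : gT -> C).

Let DJ g : (g ^ b \in D)%g = (g \in D). Proof. exact: groupJr. Qed.
Let bJK g : ((g ^ b) ^ b = g)%g. Proof. by rewrite -conjgM b2 conjg1. Qed.

Lemma pos_coef_heltD g h (s t : C) : g \in D -> h \in D ->
  pos_coef g (helt h s t) = s *+ (g == h).
Proof.
move=> gD hD; case: eqP => [->|/eqP/negPf gh]; first exact: pos_coef_helt.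
have gzh : (g * z == h)%g = false.
  by apply/eqP => gzh; move: hD; rewrite -gzh Dz gD.
rewrite /pos_coef heltE !ffunE gh (inj_eq (mulIg z)) gh gzh.
have -> : (g == h * z)%g = false.
  by apply/eqP => ghz; move: gD; rewrite ghz Dz hD.
by rewrite ![_ *: _]mulr0 !addr0.
Qed.

Lemma neg_coef_heltD g h (s t : C) : g \in D -> h \in D ->
  neg_coef g (helt h s t) = t *+ (g == h).
Proof.
move=> gD hD; case: eqP => [->|/eqP/negPf gh]; first exact: neg_coef_helt.
have gzh : (g * z == h)%g = false.
  by apply/eqP => gzh; move: hD; rewrite -gzh Dz gD.
rewrite /neg_coef heltE !ffunE gh (inj_eq (mulIg z)) gh gzh.
have -> : (g == h * z)%g = false.
  by apply/eqP => ghz; move: gD; rewrite ghz Dz hD.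
by rewrite ![_ *: _]mulr0 !addr0 subr0.
Qed.

(** D is a set of representatives modulo z. *)
Lemma sum_heltD x : x = \sum_(g in D) helt g (pos_coef g x) (neg_coef g x).
Proof.
pose F g := x g *: lambda C g.
transitivity (\sum_(g in D) (F g + F (g * z)%g)); last first.
  apply: eq_bigr => g _; rewrite heltE /F /pos_coef /neg_coef.
  by congr (_ *: _ + _ *: _); field.
rewrite {1}[x]galg_sum_lambda (bigID (mem D)) /= big_split /=; congr (_ + _).
by rewrite (reindex_inj (mulIg z)); apply: eq_bigl => g; rewrite Dz negbK.
Qed.

(** Passing from g to g z only changes signs, so it is enough to test degrees
    represented in D. *)
Lemma graded_intro S :
  1 \in S -> (forall x y, x \in S -> y \in S -> x * y \in S) ->
  (forall x, x \in S -> gstar x \in S) ->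
  (forall x g, g \in D -> x \in S -> helt g (pos_coef g x) (neg_coef g x) \in S) ->
  (forall g s t, g \in D -> helt g s t \in S -> helt (g ^ b)%g t s \in S) ->
  graded_subalgebra S.
Proof.
have zb g : ((g * z) ^ b = g ^ b * z)%g by rewrite conjMg (conjgE z) zC mulKg.
move=> S1 SM Ss Sc Sw; split=> [//|//|//|x g xS|g s t].
  have [gD|gD] := boolP (g \in D); first exact: Sc.
  have gzD : (g * z)%g \in D by rewrite Dz.
  have := Sc x _ gzD xS; rewrite helt_z /pos_coef /neg_coef -mulgA z2 mulg1.
  by rewrite opprB addrC.
have [gD|gD] := boolP (g \in D); first exact: Sw.
have gzD : (g * z)%g \in D by rewrite Dz.
rewrite -[t]opprK -helt_z => /(Sw _ _ _ gzD).
by rewrite zb helt_z opprK -memvN -scaleN1r heltZ !mulN1r !opprK.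
Qed.

(** Generators of the graded subalgebras that contain the idempotents of C[<z>]:
    the positive parts of the elements of B, and their images under the swap. *)
Definition split_gen (u : gT * bool) : galg C gT :=
  if u.2 then helt u.1 1 0 else helt (u.1 ^ b)%g 0 1.

Definition split_space B := <<[seq split_gen u | u in setX B [set: bool]]>>%VS.

(** The graded subalgebras whose component of degree 1 consists of scalars: each
    degree in B carries a line, whose slope is given by chi. *)
Definition char_space chi B := <<[seq helt g 1 (chi g) | g in B]>>%VS.

(** Expansion along D reduces one direction to generators; for the other one, the
    coordinates outside B vanish on the generators, hence on their span. *)
Lemma memv_splitP B x : B \subset D ->
  x \in split_space B <-> {in D, forall g, (pos_coef g x != 0 -> g \in B) /\
                                    (neg_coef g x != 0 -> (g ^ b)%g \in B)}.
Proof.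
move=> /subsetP sBD; split=> [xB g gD|xB].
  split; apply: contra_neqT => gB.
    apply: (span_linear0 (f := pos_coef g) _ xB) => _ /imageP[[h e] + ->].
    rewrite !inE andbT /split_gen /= => hB; have hD := sBD h hB.
    case: e; rewrite pos_coef_heltD ?DJ // ?mul0rn //.
    by case: (eqVneq g h) => // gh; rewrite gh hB in gB.
  apply: (span_linear0 (f := neg_coef g) _ xB) => _ /imageP[[h e] + ->].
  rewrite !inE andbT /split_gen /= => hB; have hD := sBD h hB.
  case: e; rewrite neg_coef_heltD ?DJ // ?mul0rn //.
  by case: (eqVneq g (h ^ b)%g) => // gh; rewrite gh bJK hB in gB.
rewrite [x]sum_heltD memv_suml // => g gD; have [xp xn] := xB g gD.
have -> : helt g (pos_coef g x) (neg_coef g x) =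
    pos_coef g x *: helt g 1 0 + neg_coef g x *: helt g 0 1.
  by rewrite !heltZ heltD !mulr1 !mulr0 addr0 add0r.
apply: memvD.
  have [->|/xp gB] := eqVneq (pos_coef g x) 0; first by rewrite scale0r mem0v.
  by apply/memvZ/memv_span/imageP; exists (g, true); rewrite // !inE gB.
have [->|/xn gB] := eqVneq (neg_coef g x) 0; first by rewrite scale0r mem0v.
apply/memvZ/memv_span/imageP; exists ((g ^ b)%g, false); rewrite ?inE ?gB //.
by rewrite /split_gen /= bJK.
Qed.

Lemma memv_split_helt B g (s t : C) : B \subset D -> g \in D ->
  helt g s t \in split_space B <->
  (s != 0 -> g \in B) /\ (t != 0 -> (g ^ b)%g \in B).
Proof.
move=> sBD gD; rewrite memv_splitP //; split=> [/(_ g gD)|st h hD].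
  by rewrite pos_coef_helt ?neg_coef_helt.
rewrite pos_coef_heltD // neg_coef_heltD //; case: (eqVneq h g) => [->|_] //.
by rewrite !mulr0n eqxx.
Qed.

Lemma dim_split_space B : B \subset D -> \dim (split_space B) = (2 * #|B|)%N.
Proof.
move=> /subsetP sBD.
pose phi (u : gT * bool) : {linear galg C gT -> C^o} :=
  if u.2 then (pos_coef u.1 : {linear galg C gT -> C^o})
  else (neg_coef (u.1 ^ b)%g : {linear galg C gT -> C^o}).
rewrite (dim_span_dual (phi := phi)); first by rewrite cardsX cardsT card_bool mulnC.
case=> [g e] [h f]; rewrite !inE !andbT /= => gB hB.
have gD := sBD g gB; have hD := sBD h hB.
rewrite /phi /split_gen xpair_eqE; case: e; case: f => /=;
  rewrite ?pos_coef_heltD ?neg_coef_heltD ?DJ ?andbT ?andbF //= ?mul0rn //.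
suff -> : ((g ^ b)%g == (h ^ b)%g) = (g == h) by [].
by apply/eqP/eqP => [/conjg_inj|->].
Qed.

Lemma split_space_graded B : B \subset D -> graded_subalgebra (split_space B).
Proof.
move=> sBD; have sB g := subsetP sBD g.
apply: graded_intro => [|x y|x|x g gD xB|g s t gD].
- by rewrite -helt11; apply/memv_split_helt; rewrite ?group1 // conj1g group1.
- apply: span_mul => _ _ /imageP[[g e] + ->] /imageP[[h f] + ->].
  rewrite !inE !andbT /= => gB hB; have ghB := groupM gB hB.
  have ghD := sB _ ghB; rewrite /split_gen; case: e; case: f;
    rewrite /= heltM ?(mulr0, mul0r, mulr1);
    rewrite ?helt00 ?mem0v -?conjMg //;
    by apply/memv_split_helt; rewrite ?DJ ?bJK ?ghD ?ghB ?eqxx.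
- apply: span_star => _ /imageP[[g e] + ->]; rewrite !inE andbT /= => gB.
  have gVB : (g^-1)%g \in B by rewrite groupV.
  have gVD := sB _ gVB.
  rewrite /split_gen; case: e; rewrite helt_star conjC0 conjC1 -?conjVg;
   by apply/memv_split_helt; rewrite ?DJ ?bJK ?gVD ?gVB ?eqxx.
- by apply/memv_split_helt => //; apply: (iffLR (memv_splitP _ sBD)).
- move/(memv_split_helt _ _ sBD gD) => [sP tP]; apply/memv_split_helt => //.
    by rewrite DJ.
  by rewrite bJK.
Qed.

Lemma memv_charP chi B x : B \subset D ->
  x \in char_space chi B <-> {in D, forall g,
    if g \in B then neg_coef g x = chi g * pos_coef g x
    else pos_coef g x = 0 /\ neg_coef g x = 0}.
Proof.
move=> /subsetP sBD; split=> [xB g gD|xB].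
  have gen (f : {linear galg C gT -> C^o}) :
      {in B, forall h, f (helt h 1 (chi h)) = 0} -> f x = 0.
    by move=> f0; apply: (span_linear0 _ xB) => _ /imageP[h /f0 ? ->].
  case: ifP => gB; last first.
    split; [apply: (gen (pos_coef g)) | apply: (gen (neg_coef g))] => h hB;
      rewrite /= ?pos_coef_heltD ?neg_coef_heltD ?(sBD h hB) //;
      case: (eqVneq g h) => [gh|_]; rewrite ?mulr0n //;
      by rewrite gh hB in gB.
  apply/eqP; rewrite -subr_eq0; apply/eqP.
  pose f : {linear galg C gT -> C^o} :=
    (neg_coef g : {linear galg C gT -> C^o}) \-
    (chi g \*: (pos_coef g : {linear galg C gT -> C^o})).
  apply: (gen f) => h hB; rewrite /f /= pos_coef_heltD ?neg_coef_heltD ?(sBD h hB) //.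
  case: (eqVneq g h) => [->|_]; rewrite ?mulr1n ?mulr0n ?scaler0 ?subrr //.
  by rewrite [_ *: _]mulr1 subrr.
rewrite [x]sum_heltD memv_suml // => g gD; have := xB g gD.
case: ifP => [gB ->|_ [-> ->]]; last by rewrite helt00 mem0v.
have -> : helt g (pos_coef g x) (chi g * pos_coef g x) =
    pos_coef g x *: helt g 1 (chi g) by rewrite heltZ mulr1 mulrC.
by apply/memvZ/memv_span/imageP; exists g.
Qed.

Lemma memv_char_helt chi B g (s t : C) : B \subset D -> g \in D ->
  helt g s t \in char_space chi B <->
  if g \in B then t = chi g * s else s = 0 /\ t = 0.
Proof.
move=> sBD gD; rewrite memv_charP //; split=> [/(_ g gD)|st h hD].
  by rewrite pos_coef_helt ?neg_coef_helt.
rewrite pos_coef_heltD // neg_coef_heltD //; case: (eqVneq h g) => [->|_] //.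
by rewrite !mulr0n mulr0; case: ifP.
Qed.

Lemma dim_char_space chi B : B \subset D -> \dim (char_space chi B) = #|B|.
Proof.
move=> /subsetP sBD.
pose phi g : {linear galg C gT -> C^o} := pos_coef g.
rewrite (dim_span_dual (phi := phi)) // => g h gB hB.
by rewrite /phi /= pos_coef_heltD ?sBD.
Qed.

(** The unitary characters of B that conjugation by b inverts; the three clauses
    answer to products, adjoints and the swap in [char_space chi B]. *)
Definition twisted_char chi B : Prop :=
  [/\ {in B &, {morph chi : g h / (g * h)%g >-> g * h}},
      {in B, forall g, chi g * Num.conj (chi g) = 1} &
      {in B, forall g, (g ^ b)%g \in B /\ chi (g ^ b)%g * chi g = 1}].

Lemma twisted_char1 chi B : twisted_char chi B -> chi 1%g = 1.
Proof.
case=> chiM chiU _; have := chiU _ (group1 B); have := chiM _ _ (group1 B) (group1 B).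
rewrite mulg1 => /= chi2 chi_unit; rewrite -[LHS]mulr1 -[X in _ * X]chi_unit.
by rewrite mulrA -chi2.
Qed.

Lemma char_space_graded chi B : B \subset D -> twisted_char chi B ->
  graded_subalgebra (char_space chi B).
Proof.
move=> sBD chiP; have chi1 := twisted_char1 chiP; case: chiP => chiM chiU chib.
have sB g := subsetP sBD g.
have bB g : (g ^ b \in B)%g = (g \in B).
  by apply/idP/idP => [/chib[]|/chib[]//]; rewrite bJK.
have gen g : g \in B -> helt g 1 (chi g) \in char_space chi B.
  by move=> gB; apply/memv_span/imageP; exists g.
apply: graded_intro => [|x y|x|x g gD xB|g s t gD].
- by rewrite -helt11 -[X in helt 1 1 X]chi1 gen ?group1.
- apply: span_mul => _ _ /imageP[g gB ->] /imageP[h hB ->].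
  by rewrite heltM mulr1 -chiM // gen ?groupM.
- apply: span_star => _ /imageP[g gB ->]; rewrite helt_star conjC1.
  have -> : Num.conj (chi g) = chi g^-1%g; last by rewrite gen ?groupV.
  apply: (@mulfI _ (chi g)).
    by apply: contra_eq_neq (chiU g gB) => ->; rewrite mul0r eq_sym oner_eq0.
  by rewrite chiU // -chiM ?groupV // mulgV chi1.
- by apply/memv_char_helt => //; apply: (iffLR (memv_charP _ _ sBD)).
move/(memv_char_helt _ _ _ sBD gD) => st; apply/memv_char_helt; rewrite ?DJ //.
rewrite bB; move: st; case: ifP => [gB ->|_ []//].
by rewrite mulrA (chib g gB).2 mul1r.
Qed.

Lemma eq_char_space chi chi' B : {in B, chi =1 chi'} -> char_space chi B = char_space chi' B.
Proof.
move=> eq_chi; congr (<<_>>%VS); apply/eq_in_map => g.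
by rewrite mem_enum => /eq_chi->.
Qed.

Lemma char_space1 chi : chi 1%g = 1 -> char_space chi 1 = 1%VS.
Proof.
move=> chi1; rewrite /char_space; have -> : [seq helt g 1 (chi g) | g in 1%G] = [:: 1].
  by rewrite /image_mem enum_set1 /= chi1 helt11.
by rewrite span_seq1.
Qed.

Lemma split_space_full : split_space D = fullv.
Proof.
apply/vspaceP=> x; rewrite memvf; apply/memv_splitP => // g gD.
by rewrite DJ.
Qed.

Lemma graded_sub S (T : {vspace galg C gT}) : graded_subalgebra S ->
  (forall g s t, g \in D -> helt g s t \in S -> helt g s t \in T) ->
  (S <= T)%VS.
Proof.
move=> [_ _ _ Sc _] ST; apply/subvP => x xS; rewrite [x]sum_heltD.
by apply: memv_suml => g gD; apply/ST/Sc.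
Qed.

(** Multiplying by the positive idempotent, which lies in S, isolates the positive
    part of a homogeneous element, and the swap then isolates its negative part;
    so S is determined by the subgroup of those g whose positive part is in S. *)
Lemma graded_split S : graded_subalgebra S -> helt 1 1 0 \in S ->
  exists B : {group gT}, B \subset D /\ S = split_space B.
Proof.
move=> gS P_S; have [S1 SM Ss Sc Sw] := gS.
have BgS : group_set [set g in D | helt g 1 0 \in S].
  apply/group_setP; split=> [|g h]; first by rewrite inE group1.
  rewrite !inE => /andP[gD gS'] /andP[hD hS]; rewrite groupM //=.
  by have := SM _ _ gS' hS; rewrite heltM mulr0 mulr1.
exists (Group BgS); have sBD : Group BgS \subset D.
  by apply/subsetP=> g; rewrite inE => /andP[].
have pos g (s t : C) : helt g s t \in S -> s != 0 -> helt g 1 0 \in S.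
  move=> gS' s0; have := memvZ s^-1 (SM _ _ gS' P_S).
  by rewrite heltM mulg1 mulr1 mulr0 heltZ (mulVf s0) mulr0.
split=> //; apply: subv_anti; apply/andP; split.
  apply: graded_sub => // g s t gD gS'; apply/memv_split_helt => //.
  by rewrite !inE gD DJ gD; split; [apply: pos gS' | apply: pos (Sw _ _ _ gS')].
apply/span_subvP => _ /imageP[[g e] + ->]; rewrite !inE andbT /= => /andP[_ gS'].
by rewrite /split_gen; case: e; [apply: gS' | apply: Sw].
Qed.

(** For x = [helt g s t] in S, the element x x^* lies in degree 1, where S has
    no nonzero multiple of a minimal idempotent of C[<z>]; so x x^* is a scalar and
    |s| = |t|. Thus a homogeneous component has dimension at most one: the
    difference of two of its elements with the same first coordinate has first
    coordinate zero, hence vanishes. The slopes of these lines form the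
    character. *)
Lemma graded_char S : graded_subalgebra S -> helt 1 1 0 \notin S ->
  exists B : {group gT}, exists chi,
    [/\ B \subset D, twisted_char chi B & S = char_space chi B].
Proof.
move=> gS P_nS; have [S1 SM Ss Sc Sw] := gS.
have N_S (t : C) : helt 1 0 t \in S -> t = 0.
  move=> /Sw; rewrite conj1g => tS; apply: contraNeq P_nS => t0.
  by have := memvZ t^-1 tS; rewrite heltZ (mulVf t0) mulr0.
have norm g (s t : C) : helt g s t \in S -> t * Num.conj t = s * Num.conj s.
  move=> gS'; have := SM _ _ gS' (Ss _ gS'); rewrite helt_star heltM mulgV.
  move=> eS; apply/eqP; rewrite -subr_eq0; apply/eqP/N_S.
  have := memvB eS (memvZ (s * Num.conj s) S1).
  rewrite -helt11 heltZ mulr1 -scaleN1r heltZ !mulN1r heltD.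
  by rewrite subrr.
have uniq g (s t t' : C) :
    helt g s t \in S -> helt g 1 t' \in S -> t = t' * s.
  move=> gS1 gS2; have := memvB gS1 (memvZ s gS2).
  rewrite heltZ mulr1 -scaleN1r heltZ !mulN1r heltD subrr => /norm.
  rewrite mul0r => /eqP; rewrite mulf_eq0 conjC_eq0 orbb subr_eq0.
  by move/eqP ->; rewrite mulrC.
pose supp g := `[< exists t : C, helt g 1 t \in S >].
have Bg : group_set [set g in D | supp g].
  apply/group_setP; split=> [|g h]; rewrite !inE.
    by rewrite group1; apply/asboolP; exists 1; rewrite helt11.
  move=> /andP[gD /asboolP[s gS1]] /andP[hD /asboolP[t hS]].
  rewrite groupM //=; apply/asboolP; exists (s * t).
  by have := SM _ _ gS1 hS; rewrite heltM mulr1.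
exists (Group Bg); have sBD : Group Bg \subset D.
  by apply/subsetP=> g; rewrite inE => /andP[].
have /choice[chi chiS] g : exists t : C, supp g -> helt g 1 t \in S.
  have [/asboolP[t tS]|nsupp] := boolP (supp g); first by exists t.
  by exists 0 => sg; case/negP: nsupp.
have {}chiS g : g \in Group Bg -> helt g 1 (chi g) \in S.
  by rewrite inE => /andP[_ /chiS].
have chiU g : g \in Group Bg -> chi g * Num.conj (chi g) = 1.
  by move=> /chiS/norm ->; rewrite mul1r conjC1.
have chi0 g : g \in Group Bg -> chi g != 0.
  move=> /chiU cU; apply: contra_eq_neq cU => ->.
  by rewrite mul0r eq_sym oner_eq0.
have BP g (s t : C) : g \in D -> helt g s t \in S -> s != 0 -> g \in Group Bg.
  move=> gD gS1 s0; rewrite inE gD; apply/asboolP; exists (s^-1 * t).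
  by have := memvZ s^-1 gS1; rewrite heltZ mulVf.
exists chi; split=> //.
  split=> // [g h gB hB|g gB].
    have ghS := SM _ _ (chiS g gB) (chiS h hB); rewrite heltM mulr1 in ghS.
    by have := uniq _ _ _ _ ghS (chiS _ (groupM gB hB)); rewrite mulr1.
  have gbS := Sw _ _ _ (chiS g gB).
  have gbB : (g ^ b)%g \in Group Bg.
    by apply: BP gbS (chi0 g gB); rewrite DJ (subsetP sBD).
  by split=> //; have := uniq _ _ _ _ gbS (chiS _ gbB).
apply: subv_anti; apply/andP; split; last first.
  by apply/span_subvP => _ /imageP[g gB ->]; apply: chiS.
apply: graded_sub => // g s t gD gS1; apply/memv_char_helt => //.
case: ifP => gB; first exact: uniq gS1 (chiS g gB).
have s0 : s = 0 by apply: contraFeq gB; apply: BP gS1.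
split=> //; have /eqP := norm _ _ _ gS1.
by rewrite s0 mul0r mulf_eq0 conjC_eq0 orbb => /eqP.
Qed.

(** Inclusions between graded subalgebras are tested on homogeneous elements. *)
Lemma split_sub_split B B' : B \subset D -> B' \subset D ->
  (split_space B <= split_space B')%VS = (B \subset B').
Proof.
move=> sBD sB'D; have sB g := subsetP sBD g; apply/idP/idP=> [/subvP sBB'|/subsetP sBB'].
  apply/subsetP => g gB; have /sBB' : helt g 1 0 \in split_space B.
    by apply/memv_split_helt; rewrite ?sB // eqxx.
  by move/(memv_split_helt _ _ sB'D (sB g gB)) => [/(_ (oner_neq0 C))].
apply: graded_sub; first exact: split_space_graded.
move=> g s t gD /memv_split_helt[] // sP tP; apply/memv_split_helt => //.
by split=> [/sP|/tP] /sBB'.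
Qed.

Lemma char_sub_split chi B B' : B \subset D -> B' \subset D ->
  twisted_char chi B -> (char_space chi B <= split_space B')%VS = (B \subset B').
Proof.
move=> sBD sB'D chiP; have [_ _ chib] := chiP; have sB g := subsetP sBD g.
apply/idP/idP=> [/subvP sBB'|/subsetP sBB'].
  apply/subsetP => g gB; have /sBB' : helt g 1 (chi g) \in char_space chi B.
    by apply/memv_char_helt; rewrite ?sB ?gB ?mulr1.
  by move/(memv_split_helt _ _ sB'D (sB g gB)) => [/(_ (oner_neq0 C))].
apply: graded_sub; first exact: char_space_graded.
move=> g s t gD /(memv_char_helt _ _ _ sBD gD) st; apply/memv_split_helt => //.
move: st; case: ifP => [gB _|_ [-> ->]]; last by rewrite eqxx.
by split=> _; apply: sBB'; rewrite ?gB ?(chib g gB).1.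
Qed.

(** Already in degree 1 a plane does not fit into a line. *)
Lemma split_sub_char chi B B' : B \subset D -> B' \subset D ->
  (split_space B <= char_space chi B')%VS = false.
Proof.
move=> sBD sB'D; apply/negP => /subvP sBB'.
have /sBB' : helt 1 0 1 \in split_space B.
  by apply/memv_split_helt; rewrite ?group1 // conj1g group1.
move/(memv_char_helt _ _ _ sB'D (group1 D)); rewrite group1 mulr0 => /eqP.
by rewrite oner_eq0.
Qed.

Lemma char_sub_char chi chi' B B' : B \subset D -> B' \subset D ->
  twisted_char chi B ->
  (char_space chi B <= char_space chi' B')%VS =
    (B \subset B') && [forall g in B, chi g == chi' g].
Proof.
move=> sBD sB'D chiP; have sB g := subsetP sBD g.
apply/idP/idP=> [/subvP sBB'|/andP[/subsetP sBB' /forall_inP eqc]].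
  have in' g : g \in B -> g \in B' /\ chi g = chi' g.
    move=> gB; have /sBB' : helt g 1 (chi g) \in char_space chi B.
      by apply/memv_char_helt; rewrite ?sB ?gB ?mulr1.
    move/(memv_char_helt _ _ _ sB'D (sB g gB)); case: ifP => [_ ->|_ [/eqP]].
      by rewrite mulr1.
    by rewrite oner_eq0.
  apply/andP; split; first by apply/subsetP=> g /in'[].
  by apply/forall_inP => g /in'[_ ->].
apply/span_subvP => _ /imageP[g gB ->]; apply/memv_char_helt; rewrite ?sB //.
by rewrite sBB' // mulr1; apply/eqP/eqc.
Qed.

End Twist.

(** * Omega is cohomologous to a bicharacter *)

(** An involution u splits every vector into two eigenvectors. The last premise on
    y records that y keeps the eigenvalues of x for whatever commutes with u, so
    that the lemma can be iterated over a commuting family and an identity in the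
    algebra it generates reduces to identities between scalars. *)
Lemma eigen_split (C : numClosedFieldType) (A : algType C) (D u x : A) :
  u * u = 1 ->
  (forall y s, s = 1 \/ s = -1 -> u * y = s *: y ->
     (forall v c, u * v = v * u -> v * x = c *: x -> v * y = c *: y) ->
     D * y = 0) ->
  D * x = 0.
Proof.
move=> u2 Dy.
have eq2 : 2 *: x = (x + u * x) + (x - u * x).
  by rewrite addrACA subrr addr0 scaler_nat mulr2n.
suff: 2 *: (D * x) = 0.
  by move/eqP; rewrite scaler_eq0 pnatr_eq0 => /eqP.
rewrite scalerAr eq2 mulrDr (Dy _ 1) ?(Dy _ (-1)) ?addr0 //; auto.
- by rewrite scaleN1r mulrBr mulrA u2 mul1r opprB.
- by move=> v c uv vx; rewrite mulrBr mulrA -uv -mulrA vx -scalerAr scalerBr.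
- by rewrite scale1r mulrDr mulrA u2 mul1r addrC.
by move=> v c uv vx; rewrite mulrDr mulrA -uv -mulrA vx -scalerAr scalerDr.
Qed.

Lemma eigen_lambda (C : numClosedFieldType) (gT : finGroupType) (g h : gT)
    (s t : C) (x : galg C gT) :
  lambda C g * x = s *: x -> lambda C h * x = t *: x ->
  lambda C (g * h)%g * x = (s * t) *: x.
Proof.
by move=> gx hx; rewrite -lambdaM -mulrA hx -scalerAr gx scalerA mulrC.
Qed.

Lemma conj_KD_nu (C : numClosedFieldType) :
  Num.conj (KD_nu C) = -1 - 2 * 'i.
Proof.
rewrite /KD_nu rmorphD rmorphN1 rmorphM /= conjCi mulrN.
by rewrite -[2]/(2%:R) conjC_nat.
Qed.

Section OmegaTwist.

Variables (C : numClosedFieldType) (n : nat) (a b : 'D_(4 * n)).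
Let z := (a ^+ n)%g.
Hypotheses (zC : forall g, commute z g) (z2 : (z * z = 1)%g).
Hypothesis b2 : (b * b = 1)%g.
Let G2 := ('D_(4 * n) * 'D_(4 * n))%type.

(** The unitary of C[<z, b>] equal to 'i at the character that is -1 on both z and
    b, and to 1 at the other three. Omega is 1 on the diagonal, while the bicharacter
    is -1 at that one diagonal place, so the square of the gauge must be -1 there;
    the choice between 'i and -'i is dictated by the imaginary part of nu. *)
Definition gauge : galg C 'D_(4 * n) :=
  1 + (('i - 1) / 4) *: (1 - lambda C z - lambda C b + lambda C (b * z)%g).

(** The value of [gauge] at the character sending z to s and b to t. *)
Let vval (s t : C) : C := 1 + ('i - 1) / 4 * (1 - s - t + t * s).

Lemma eigen_gauge (f : 'D_(4 * n) -> G2) (x : galg C G2) s t :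
  {morph f : g h / (g * h)%g} -> 
  lambda C (f z) * x = s *: x -> lambda C (f b) * x = t *: x ->
  (1 + (('i - 1) / 4) *: (1 - lambda C (f z) - lambda C (f b)
    + lambda C (f (b * z)%g))) * x = vval s t *: x.
Proof.
move=> fM fz fb; rewrite mulrDl -scalerAl !(mulrDl _ _ x) !mulNr !mul1r fM.
rewrite (eigen_lambda fb fz) fz fb /vval.
by rewrite scalerDl scale1r -[X in _ = _ + X]scalerA !scalerDl !scaleNr scale1r.
Qed.

(** Both sides lie in the commutative algebra generated by the involutions z and b
    in either leg, so it is enough to compare their values at the sixteen
    characters. *)
Lemma KD_Omega_gauge :
  KD_Omega C a b * diagD gauge = gtens gauge gauge * twist C z b.
Proof.
apply/eqP; rewrite -subr_eq0; set D := _ - _; rewrite -[D]mulr1; apply/eqP.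
have cH : commute z b := zC b.
pose u1 := lambda C ((z, 1%g) : G2); pose w1 := lambda C ((b, 1%g) : G2).
pose u2 := lambda C ((1%g, z) : G2); pose w2 := lambda C ((1%g, b) : G2).
have lam2 (g h : 'D_(4 * n)) : (g * g = 1)%g -> (h * h = 1)%g ->
    lambda C ((g, h) : G2) * lambda C ((g, h) : G2) = 1.
  by move=> g2 h2; rewrite lambdaM -[(_ * _)%g]/(g * g, h * h)%g g2 h2.
have o1 : (1 * 1 = 1 :> 'D_(4 * n))%g by rewrite mulg1.
apply: (@eigen_split _ _ _ u1) => [|x1 s1 s1E u1x1 _]; first exact: lam2.
apply: (@eigen_split _ _ _ w1) => [|x2 t1 t1E w1x2 i2]; first exact: lam2.
have {}i2 v c : w1 * v = v * w1 -> v * x1 = c *: x1 -> v * x2 = c *: x2 := @i2 v c.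
have {u1x1} u1x2 : u1 * x2 = s1 *: x2.
  by apply: i2 u1x1; rewrite !lambdaM; congr (lambda C (_, _)); rewrite /= cH.
apply: (@eigen_split _ _ _ u2) => [|x3 s2 s2E u2x3 i3]; first exact: lam2.
have {}u1x3 : u1 * x3 = s1 *: x3.
  by apply: i3 u1x2; rewrite !lambdaM; congr (lambda C (_, _)); rewrite /= !(mulg1, mul1g).
have {}w1x3 : w1 * x3 = t1 *: x3.
  by apply: i3 w1x2; rewrite !lambdaM; congr (lambda C (_, _)); rewrite /= !(mulg1, mul1g).
apply: (@eigen_split _ _ _ w2) => [|x t2 t2E w2x i4]; first exact: lam2.
have {u1x3} u1x : u1 * x = s1 *: x.
  by apply: i4 u1x3; rewrite !lambdaM; congr (lambda C (_, _)); rewrite /= !(mulg1, mul1g).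
have {w1x3} w1x : w1 * x = t1 *: x.
  by apply: i4 w1x3; rewrite !lambdaM; congr (lambda C (_, _)); rewrite /= !(mulg1, mul1g).
have {u2x3} u2x : u2 * x = s2 *: x.
  by apply: i4 u2x3; rewrite !lambdaM; congr (lambda C (_, _)); rewrite /= cH.
have u12 : lambda C ((z, z) : G2) * x = (s1 * s2) *: x.
  rewrite -(eigen_lambda u1x u2x); congr (lambda C (_, _) * _).
    by rewrite /= mulg1.
  by rewrite /= mul1g.
have w12 : lambda C ((b, b) : G2) * x = (t1 * t2) *: x.
  rewrite -(eigen_lambda w1x w2x); congr (lambda C (_, _) * _).
    by rewrite /= mulg1.
  by rewrite /= mul1g.
have dv : diagD gauge * x = vval (s1 * s2) (t1 * t2) *: x.
  rewrite -(eigen_gauge (f := fun g => (g, g))) // /gauge.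
  by rewrite linearD linearZ /= !linearD !linearN /= diag1 !diag_lambda.
have vl : gtens gauge 1 * x = vval s1 t1 *: x.
  rewrite -(eigen_gauge (f := fun g => (g, 1%g))) // => [|g h]; last first.
    by congr (_, _); rewrite /= mulg1.
  rewrite /gauge -!scaleN1r !(gtensDl, gtensZl) -!lambda1 !gtens_lambda.
  by [].
have vr : gtens 1 gauge * x = vval s2 t2 *: x.
  rewrite -(eigen_gauge (f := fun g => (1%g, g))) // => [|g h]; last first.
    by congr (_, _); rewrite /= mulg1.
  rewrite /gauge -!scaleN1r !(gtensDr, gtensZr) -!lambda1 !gtens_lambda.
  by [].
have tx : twist C z b * x = ((1 + s1) / 2 + (1 - s1) / 2 * t2) *: x.
  have zp : gtens (zpos C z) 1 * x = ((1 + s1) / 2) *: x.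
    rewrite /zpos !(gtensDl, gtensZl) -!lambda1 !gtens_lambda -scalerAl.
    by rewrite mulrDl mul1r -/u1 u1x mulrC -scalerA scalerDl scale1r.
  have zn : gtens (zneg C z) 1 * x = ((1 - s1) / 2) *: x.
    rewrite /zneg -scaleN1r !(gtensDl, gtensZl) -!lambda1 !gtens_lambda.
    rewrite -scalerAl mulrDl -scalerAl mul1r -/u1 u1x mulrC -scalerA.
    by rewrite scalerBl scale1r scaleN1r.
  rewrite /twist -[zneg C z in X in _ + X]mulr1 -[lambda C b]mul1r -gtensM.
  rewrite mulrDl -mulrA zp -!lambda1 gtens_lambda -/w2 w2x -scalerAr lambda1 zn.
  by rewrite scalerA -scalerDl [t2 * _]mulrC.
(* The values at the four elements of H of the character sending z to s, b to t. *)
pose chi (s t : C) : seq C := [:: 1; s; t; t * s].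
have chi1 (i : 'I_4) : lambda C ((KD_h a b i, 1%g) : G2) * x = (chi s1 t1)`_i *: x.
  case: i => [[|[|[|[|i]]]] lt_i] //; rewrite /KD_h /= ?scale1r ?mul1r //.
  rewrite -(eigen_lambda w1x u1x); congr (lambda C (_, _) * _).
  by rewrite /= mulg1.
have chi2 (i : 'I_4) : lambda C ((1%g, KD_h a b i) : G2) * x = (chi s2 t2)`_i *: x.
  case: i => [[|[|[|[|i]]]] lt_i] //; rewrite /KD_h /= ?scale1r ?mul1r //.
  rewrite -(eigen_lambda w2x u2x); congr (lambda C (_, _) * _).
  by rewrite /= mulg1.
pose om := \sum_(i < 4) \sum_(j < 4) KD_c C i j * ((chi s1 t1)`_i * (chi s2 t2)`_j).
have Ox : KD_Omega C a b * x = om *: x.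
  rewrite mulr_suml scaler_suml; apply: eq_bigr => i _.
  rewrite mulr_suml scaler_suml; apply: eq_bigr => j _.
  rewrite -scalerAl gtens_lambda -scalerA; congr (_ *: _).
  rewrite -(eigen_lambda (chi1 i) (chi2 j)); congr (lambda C (_, _) * _).
    by rewrite /= mulg1.
  by rewrite /= mul1g.
rewrite mulrBl -!mulrA dv tx -!scalerAr Ox.
have -> : gtens gauge gauge = gtens gauge 1 * gtens 1 gauge.
  by rewrite gtensM mulr1 mul1r.
rewrite -(mulrA (gtens gauge 1)) vr -scalerAr vl !scalerA -scalerBl.
set k := (X in X *: x); suff -> : k = 0 by rewrite scale0r.
rewrite /k /om !big_ord_recl !big_ord0 !mxE /= conj_KD_nu /KD_nu /vval.
case: s1E => ->; case: t1E => ->; case: s2E => ->; case: t2E => ->;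
by field: (mulCii C).
Qed.

(** Four times the idempotent of the character that is -1 on z and on b. *)
Let vE : galg C 'D_(4 * n) := 1 - lambda C z - lambda C b + lambda C (b * z)%g.

Let vE_fact : vE = (1 - lambda C b) * (1 - lambda C z).
Proof.
by rewrite mulrBl mul1r mulrBr mulr1 lambdaM opprB addrA addrAC.
Qed.

Let lz2 : lambda C z * lambda C z = 1.
Proof. by rewrite lambdaM z2. Qed.

Let lb2 : lambda C b * lambda C b = 1.
Proof. by rewrite lambdaM b2. Qed.

Let vE_sqr : vE * vE = 4 *: vE.
Proof.
have sq (u : galg C 'D_(4 * n)) : u * u = 1 -> (1 - u) * (1 - u) = 2 *: (1 - u).
  by move=> u2; rewrite mulrBr mulr1 mulrBl mul1r u2 opprB scaler_nat mulr2n.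
have uw : (1 - lambda C z) * (1 - lambda C b) = vE.
  by rewrite vE_fact mulrBl mul1r lambda_central // [RHS]mulrBr mulr1.
have -> : vE * vE = (1 - lambda C b) * (1 - lambda C z) *
    ((1 - lambda C z) * (1 - lambda C b)) by rewrite uw -vE_fact.
rewrite mulrA -(mulrA (1 - lambda C b)) sq // -scalerAr -scalerAl -mulrA uw.
by rewrite vE_fact mulrA sq // -scalerAl scalerA -natrM.
Qed.

Let gstar_vE : gstar vE = vE.
Proof.
have zV : (z^-1 = z)%g by apply/eqP; rewrite eq_invg_mul z2.
have bV : (b^-1 = b)%g by apply/eqP; rewrite eq_invg_mul b2.
rewrite /vE -!scaleN1r !gstarD !gstarZ gstar1 !gstar_lambda invMg zV bV.
by rewrite rmorphN1 zC.
Qed.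

Lemma gstar_gauge : gstar gauge = 1 + ((- 'i - 1) / 4) *: vE.
Proof.
rewrite gstarD gstarZ gstar1 gstar_vE rmorphM fmorphV rmorphB /= conjCi conjC1.
by rewrite conjC_nat.
Qed.

Lemma gaugeV : gauge * gstar gauge = 1.
Proof.
rewrite gstar_gauge /gauge -/vE mulrDl mul1r mulrDr mulr1 -scalerAl -scalerAr.
rewrite vE_sqr !scalerA -addrA -!scalerDl -[RHS]addr0; congr (_ + _).
rewrite -[RHS](scale0r vE); by congr (_ *: _); field: (mulCii C).
Qed.

Lemma gaugeK : gstar gauge * gauge = 1.
Proof.
rewrite gstar_gauge /gauge -/vE mulrDl mul1r mulrDr mulr1 -scalerAl -scalerAr.
rewrite vE_sqr !scalerA -addrA -!scalerDl -[RHS]addr0; congr (_ + _).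
rewrite -[RHS](scale0r vE); by congr (_ *: _); field: (mulCii C).
Qed.

(** Substituting the factorization of Omega, the two copies of the coproduct of the
    gauge cancel against the conjugation by the gauge inside the coproduct. *)
Lemma KD_Delta_conj x :
  KD_Delta C a b (conjv gauge x) =
  gtens gauge gauge * twistedD z b x * gstar (gtens gauge gauge).
Proof.
have OmE : KD_Omega C a b =
    gtens gauge gauge * twist C z b * gstar (diagD gauge).
  rewrite -KD_Omega_gauge -mulrA diag_star -diagM gaugeV diag1.
  by rewrite mulr1.
rewrite /KD_Delta OmE -[Delta_s _]/(diagD _) !gstarM gstarK gstar_twist //.
rewrite /conjv /twistedD !diagM diag_star !mulrA.
rewrite -(mulrA (_ * _) (diagD (gstar gauge)) (diagD gauge)) -diagM gaugeK.
rewrite diag1 mulr1.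
by rewrite -(mulrA _ (diagD (gstar gauge)) (diagD gauge)) -diagM gaugeK diag1 mulr1.
Qed.

End OmegaTwist.

(** * The dihedral group *)

Section DihedralGroup.
Local Open Scope group_scope.

Variables (n : nat) (a b : 'D_(4 * n)).
Hypotheses (n_prime : prime n) (n_odd : odd n) (gen_ab : dihedral_generators a b).
Let z := a ^+ n.
Let c := a ^+ 2.

Lemma card_dih : #|[set: 'D_(4 * n)]| = (4 * n)%N.
Proof.
have -> : (4 * n)%N = (2 * n).*2 by rewrite -mul2n mulnA.
by apply: card_dihedral; rewrite leq_pmulr ?prime_gt0.
Qed.

Lemma dih_b2 : b * b = 1.
Proof. by have [_ _ <- _] := gen_ab; rewrite expgS expg1. Qed.

Lemma dih_bV : b^-1 = b.
Proof. by apply/eqP; rewrite eq_invg_mul dih_b2. Qed.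

Lemma dih_aJ : a ^ b = a^-1.
Proof.
have [_ _ _ ba] := gen_ab.
by rewrite conjgE dih_bV mulgA ba -mulgA dih_b2 mulg1.
Qed.

Lemma cyc_norm x : x ^ b = x^-1 -> <[b]> \subset 'N(<[x]>).
Proof.
move=> xb; rewrite cycle_subG; apply/normP; rewrite -cycleJ xb.
exact: cycleV.
Qed.

(** The group is the product of <a> and <b>, so its order 4n leaves no room for a
    or b to have a smaller order than the relations allow. *)
Lemma dih_orders : #[a] = (2 * n)%N /\ #[b] = 2%N.
Proof.
have [gG aN b2 _] := gen_ab.
have n_gt0 := prime_gt0 n_prime.
have oa : (#[a] %| 2 * n)%N by rewrite order_dvdn aN.
have ob : (#[b] %| 2)%N by rewrite order_dvdn b2.
have oG : (4 * n <= #[a] * #[b])%N.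
  apply: leq_trans (eq_leq (esym card_dih)) _; rewrite -gG.
  have -> : <<[set a; b]>> = <[a]> * <[b]>.
    by rewrite -norm_joinEr ?(cyc_norm dih_aJ) // joing_idl joing_idr.
  by rewrite mul_cardG leq_pmulr ?cardG_gt0.
have lb : (#[b] <= 2)%N by exact: dvdn_leq ob.
have la : (#[a] <= 2 * n)%N by rewrite dvdn_leq // muln_gt0.
have b_2 : #[b] = 2%N.
  apply/eqP; rewrite eqn_leq lb /= leqNgt; apply: contraL oG => b1.
  rewrite -ltnNge; apply: leq_ltn_trans (leq_mul la (leqnn _)) _.
  have -> : #[b] = 1%N by apply/eqP; rewrite eqn_leq order_gt0 -ltnS b1.
  by rewrite muln1 ltn_pmul2r.
split=> //; apply/eqP; rewrite eqn_leq la /=.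
by rewrite -(leq_pmul2r (ltn0Sn 1)) mulnAC; move: oG; rewrite b_2.
Qed.

Lemma dih_oc : #[c] = n.
Proof. by rewrite orderXdiv dih_orders.1 ?dvdn_mulr // mulKn. Qed.

Lemma dih_cX_mod i : c ^+ (i %% n) = c ^+ i.
Proof. by have := expg_mod_order c i; rewrite dih_oc. Qed.

Lemma dih_oz : #[z] = 2%N.
Proof.
by rewrite orderXdiv dih_orders.1 ?dvdn_mull // mulnK ?prime_gt0.
Qed.

Lemma dih_z2 : z * z = 1.
Proof. by rewrite -[RHS](expg_order z) dih_oz expgS expg1. Qed.

Lemma dih_z_neq1 : z != 1.
Proof. by rewrite -order_eq1 dih_oz. Qed.

Lemma dih_zC g : commute z g.
Proof.
have [gG _ _ _] := gen_ab.
have : g \in 'C[z].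
  apply: subsetP (in_setT g); rewrite -gG gen_subG subUset !sub1set.
  apply/andP; split; apply/cent1P; first exact/commuteX/commute_refl.
  have zV : z^-1 = z by apply/eqP; rewrite eq_invg_mul dih_z2.
  by apply/commute_sym/commgP/conjg_fixP; rewrite conjXg dih_aJ expgVn.
by move/cent1P/commute_sym.
Qed.

Lemma dih_cJ : c ^ b = c^-1.
Proof. by rewrite conjXg dih_aJ expgVn. Qed.

Lemma dih_cXJ k : (c ^+ k) ^ b = (c ^+ k)^-1.
Proof. by rewrite conjXg dih_cJ expgVn. Qed.

Definition dihD : {group 'D_(4 * n)} := <[c]> <*> <[b]>.

Lemma dihDE : dihD = <[c]> * <[b]> :> {set _}.
Proof. by rewrite -norm_joinEr ?cyc_norm ?dih_cJ. Qed.

Lemma card_dihD : #|dihD| = (2 * n)%N.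
Proof.
have oc : #|<[c]>| = n := dih_oc; have ob : #|<[b]>| = 2%N := dih_orders.2.
by rewrite dihDE coprime_cardMg oc ob ?coprimen2 // mulnC.
Qed.

Lemma dihD_c : c \in dihD.
Proof. by rewrite mem_gen // inE cycle_id. Qed.

Lemma dihD_b : b \in dihD.
Proof. by rewrite mem_gen // inE cycle_id orbT. Qed.

Lemma dihDP g : g \in dihD ->
  exists k : 'I_n, g = c ^+ k \/ g = c ^+ k * b.
Proof.
rewrite dihDE => /mulsgP[_ v /cycleP[i ->] vb ->].
exists (Ordinal (ltn_pmod i (prime_gt0 n_prime))).
move: vb; rewrite [nat_of_ord _]/= dih_cX_mod cycle2g ?dih_orders.2 // !inE.
by case/orP => /eqP->; [left; rewrite mulg1 | right].
Qed.

(** For n odd a = a^(n+1) a^n is a power of c times z, so D and z generate. *)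
Lemma dihDz_or g : (g \in dihD) || (g * z \in dihD).
Proof.
have [gG aN _ _] := gen_ab.
have nz : <[z]> \subset 'N(dihD).
  by rewrite cycle_subG (subsetP (cent_sub _)) //; apply/centP=> x _; apply: dih_zC.
have aM : a \in dihD <*> <[z]>.
  have <- : c ^+ n.+1./2 * z = a.
    rewrite -expgM mul2n even_halfK /= ?n_odd // -expgD addSn addnn -mul2n.
    by rewrite expgS aN mulg1.
  apply: groupM; last by apply: (subsetP (joing_subr dihD <[z]>)); apply: cycle_id.
  by apply: (subsetP (joing_subl dihD <[z]>)); rewrite groupX ?dihD_c.
have : g \in dihD <*> <[z]>.
  apply: subsetP (in_setT g); rewrite -gG gen_subG subUset !sub1set aM /=.
  by rewrite mem_gen // inE dihD_b.
rewrite norm_joinEr // => /mulsgP[u v uD].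
rewrite /= cycle2g ?dih_oz //.
rewrite !inE => /orP[]/eqP-> ->; first by rewrite mulg1 uD.
by rewrite -mulgA dih_z2 mulg1 uD orbT.
Qed.

(** Otherwise D, of order 2n, would be the whole group. *)
Lemma dihD_z : z \notin dihD.
Proof.
apply/negP => zD; have : (#|[set: 'D_(4 * n)]| <= #|dihD|)%N.
  apply/subset_leq_card/subsetP => g _; have /orP[//|gz] := dihDz_or g.
  by rewrite -(groupMr _ zD).
by rewrite card_dih card_dihD leq_pmul2r ?prime_gt0.
Qed.

Lemma dihDz g : (g * z \in dihD) = (g \notin dihD).
Proof.
apply/idP/idP=> [gzD|/negPf gD]; last by have := dihDz_or g; rewrite gD.
by apply: contra dihD_z => gD; rewrite -(groupMl _ gD).
Qed.

Lemma dih_b_notin : b \notin <[c]>.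
Proof.
apply/negP=> bc; have : (#|<[b]>| %| #|<[c]>|)%N by rewrite cardSg ?cycle_subG.
have oc : #|<[c]>| = n := dih_oc; have ob : #|<[b]>| = 2%N := dih_orders.2.
by rewrite oc ob dvdn2 n_odd.
Qed.

Lemma dih_refl_notin k : c ^+ k * b \notin <[c]>.
Proof. by rewrite groupMl ?mem_cycle ?dih_b_notin. Qed.

Lemma dih_reflM i k : (c ^+ i * b) * (c ^+ k * b) = c ^+ i * (c ^+ k)^-1.
Proof. by rewrite -dih_cXJ conjgE dih_bV !mulgA. Qed.

Lemma dih_refl2 k : (c ^+ k * b) * (c ^+ k * b) = 1.
Proof. by rewrite dih_reflM mulgV. Qed.

Lemma dih_refl_cycle k : <[c ^+ k * b]> = [set 1; c ^+ k * b].
Proof.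
apply: cycle2g; apply: nt_prime_order => //; first by rewrite expgS expg1 dih_refl2.
by apply: contraNneq (dih_refl_notin k) => ->; rewrite group1.
Qed.

Lemma dih_cX_eq (i j : 'I_n) : (c ^+ i == c ^+ j) = (i == j).
Proof. by rewrite eq_expg_mod_order dih_oc !modn_small. Qed.

(** Conjugation by b sends c^k b to c^(-k) b, and c has odd order. *)
Lemma dih_refl_stable (k : 'I_n) :
  (c ^+ k * b) ^ b \in <[c ^+ k * b]> -> k = 0%N :> nat.
Proof.
rewrite dih_refl_cycle !inE conjMg dih_cXJ (conjgE b) mulKg.
case/orP; last rewrite (inj_eq (mulIg b)).
  by rewrite -eq_invg_mul invgK => /eqP cb; case/negP: dih_b_notin; rewrite -cb mem_cycle.
rewrite eq_invg_mul -expgD -order_dvdn dih_oc addnn -muln2 Gauss_dvdl ?coprimen2 //.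
by case: k => [[|k] ltk] //= /(dvdn_leq (ltn0Sn _)); rewrite leqNgt ltk.
Qed.

(** As <c> has prime order, B contains it or meets it trivially; in the latter
    case two elements c^i b and c^k b of B have product c^(i - k), so B holds at
    most one such element. *)
Lemma dih_subgroups (B : {group 'D_(4 * n)}) : B \subset dihD ->
  [\/ B = 1%G, exists k : 'I_n, B = <[c ^+ k * b]>%G, B = <[c]>%G | B = dihD].
Proof.
move=> sBD; have pc : prime #|<[c]>| by rewrite -orderE dih_oc.
have [cB|cB] := prime_subgroupVti B pc; last first.
  have [/existsP[k kB]|/existsPn noB] := boolP [exists k : 'I_n, c ^+ k * b \in B].
    constructor 2; exists k; apply/val_inj/eqP; rewrite eqEsubset cycle_subG kB /= andbT.
    apply/subsetP => g gB; rewrite dih_refl_cycle !inE.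
    have [i [gE|gE]] := dihDP (subsetP sBD g gB).
      have : g \in B :&: <[c]> by rewrite inE gB gE mem_cycle.
      by rewrite cB inE => ->.
    have : g * (c ^+ k * b) \in B :&: <[c]>.
      by rewrite inE groupM //= gE dih_reflM groupM ?groupV ?mem_cycle.
    by rewrite cB inE gE dih_reflM -eq_mulgV1 => /eqP->; rewrite eqxx orbT.
  constructor 1; apply/val_inj/trivgP/subsetP => g gB.
  have [i [gE|gE]] := dihDP (subsetP sBD g gB).
    by have : g \in B :&: <[c]> by [rewrite inE gB gE mem_cycle]; rewrite cB.
  by have := noB i; rewrite -gE gB.
have [bB|bB] := boolP (b \in B).
  by constructor 4; apply/val_inj/eqP; rewrite eqEsubset sBD join_subG cB cycle_subG.
constructor 3; apply/val_inj/eqP; rewrite eqEsubset cB andbT /=.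
apply/subsetP=> g gB; have [i [->|gE]] := dihDP (subsetP sBD g gB).
  exact: mem_cycle.
by case/negP: bB; move: gB; rewrite gE groupMl // (subsetP cB) ?mem_cycle.
Qed.
End DihedralGroup.

(** * The coideal subalgebras attached to the nodes *)

(** For n prime, any n-th root of unity other than 1 is primitive, and 1 is not a
    root of 1 + X + ... + X^(n-1) in characteristic zero. *)
Lemma prime_prim_root (C : numClosedFieldType) (n : nat) :
  prime n -> exists zeta : C, n.-primitive_root zeta.
Proof.
move=> n_prime; have n_gt0 := prime_gt0 n_prime.
pose p : {poly C} := \poly_(i < n) 1.
have /closed_rootP[x /rootP px] : size p != 1.
  by rewrite size_poly_eq ?oner_eq0 // neq_ltn prime_gt1 ?orbT.
have sum0 : \sum_(i < n) x ^+ i = 0.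
  by rewrite -[RHS]px horner_poly; apply: eq_bigr => i _; rewrite mul1r.
have xn : x ^+ n = 1 by apply/eqP; rewrite -subr_eq0 subrX1 sum0 mulr0.
have [m m_prim m_n] := prim_order_exists n_gt0 xn.
have /primeP[_ /(_ m m_n)/orP[/eqP m1|/eqP <-]] := n_prime; last by exists x.
have x1 : x = 1 by have := prim_expr_order m_prim; rewrite m1.
move: sum0; rewrite x1 (eq_bigr (fun=> 1)) => [|i _]; last by rewrite expr1n.
by rewrite sumr_const card_ord => /eqP; rewrite pnatr_eq0 eqn0Ngt n_gt0.
Qed.

Lemma node_dim_bounds n (s : KD_node n) :
  (1 < n)%N -> (1 < node_dim s < 4 * n)%N.
Proof. by case: s => [i|k||j|||] /=; lia. Qed.

Section Nodes.

Variables (C : numClosedFieldType) (n : nat) (a b : 'D_(4 * n)).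
Hypotheses (n_prime : prime n) (n_odd : odd n) (gen_ab : dihedral_generators a b).
Variable zeta : C.
Hypothesis zeta_prim : n.-primitive_root zeta.

Local Notation G := 'D_(4 * n).
Let z : G := (a ^+ n)%g.
Let c : G := (a ^+ 2)%g.
Let D : {group G} := dihD a b.

Let zC := dih_zC n_prime gen_ab.
Let z2 := dih_z2 n_prime gen_ab.
Let z1 := dih_z_neq1 n_prime gen_ab.
Let b2 := dih_b2 gen_ab.
Let Dz := dihDz n_prime n_odd gen_ab.
Let Db := dihD_b a b.
Let Dc := dihD_c a b.
Let oc := dih_oc n_prime gen_ab.

Let cn : (c ^+ n = 1)%g. Proof. by have := expg_order c; rewrite oc. Qed.

Let DcX k : (c ^+ k)%g \in D. Proof. exact: groupX. Qed.

(** A discrete logarithm in base c, with junk value 0 outside <c>; it lets the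
    characters of <c> be total functions on the group. *)
Definition log_c (g : G) : nat :=
  if [pick i : 'I_n | g == (c ^+ i)%g] is Some i then i else 0%N.
Definition rot_char (j : nat) (g : G) : C := zeta ^+ (j * log_c g).
Definition refl_sgn (g : G) : C := if g \in <[c]>%g then 1 else -1.

Lemma rot_charX j k : rot_char j (c ^+ k)%g = zeta ^+ (j * k).
Proof.
apply/eqP; rewrite (eq_prim_root_expr zeta_prim) -(modnMmr j k).
suff -> : log_c (c ^+ k)%g = (k %% n)%N by [].
rewrite /log_c; case: pickP => [i /eqP/esym/eqP|/(_ (Ordinal (ltn_pmod k (prime_gt0 n_prime))))].
  by rewrite eq_expg_mod_order oc (modn_small (ltn_ord i)) => /eqP.
by rewrite /= (dih_cX_mod n_prime gen_ab) eqxx.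
Qed.

Lemma rot_charP j : twisted_char b (rot_char j) <[c]>.
Proof.
have zu k : zeta ^+ k * Num.conj (zeta ^+ k) = 1.
  rewrite -normCK normrX; suff -> : `|zeta| = 1 by rewrite !expr1n.
  apply/eqP; rewrite -(@pexpr_eq1 _ _ n) ?prime_gt0 ?normr_ge0 // -normrX.
  by rewrite (prim_expr_order zeta_prim) normr1.
split=> [_ _ /cycleP[i ->] /cycleP[k ->]|_ /cycleP[k ->]|_ /cycleP[k ->]].
- by rewrite -expgD !rot_charX mulnDr exprD.
- by rewrite rot_charX zu.
rewrite dih_cXJ // groupV mem_cycle; split=> //.
have -> : ((c ^+ k)^-1 = c ^+ (n.-1 * k))%g.
  apply/eqP; rewrite eq_invg_mul -expgD -mulSn prednK ?prime_gt0 //.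
  by rewrite -order_dvdn oc dvdn_mulr.
rewrite !rot_charX -exprD -mulnDr -mulSnr prednK ?prime_gt0 //.
by rewrite mulnCA exprM (prim_expr_order zeta_prim) expr1n.
Qed.

Lemma triv_charP (B : {group G}) : b \in B -> twisted_char b (fun=> 1 : C) B.
Proof.
move=> bB; split=> [g h _ _|g _|g gB]; rewrite ?mul1r ?conjC1 //.
by rewrite groupJ.
Qed.

Lemma refl_sgnP (B : {group G}) : b \in B -> B \subset D ->
  twisted_char b refl_sgn B.
Proof.
move=> bB /subsetP sBD.
have sgnE g : refl_sgn g = 1 \/ refl_sgn g = -1 by rewrite /refl_sgn; case: ifP; auto.
have nc : (<[b]> \subset 'N(<[c]>))%g by apply/cyc_norm/dih_cJ.
split=> [g h gB hB|g _|g gB].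
- have mem (g' h' : G) : g' \in <[c]>%g -> ((g' * h')%g \in <[c]>%g) = (h' \in <[c]>%g).
    by move=> gc; rewrite groupMl.
  rewrite /refl_sgn; have [gc|gc] := boolP (g \in <[c]>%g).
    by rewrite mem // mul1r.
  have [hc|hc] := boolP (h \in <[c]>%g); first by rewrite groupMr ?(negPf gc) ?mulr1.
  have [i [gE|gE]] := dihDP n_prime gen_ab (sBD g gB).
    by rewrite gE mem_cycle in gc.
  have [k [hE|hE]] := dihDP n_prime gen_ab (sBD h hB).
    by rewrite hE mem_cycle in hc.
  by rewrite gE hE dih_reflM // groupM ?groupV ?mem_cycle // mulrNN mulr1.
- by case: (sgnE g) => ->; rewrite ?rmorphN1 ?conjC1 ?mulrNN mulr1.
rewrite groupJ //; split=> //.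
have -> : refl_sgn (g ^ b)%g = refl_sgn g.
  by rewrite /refl_sgn memJ_norm // (subsetP nc) ?cycle_id.
by case: (sgnE g) => ->; rewrite ?mulrNN mulr1.
Qed.

(** A node is encoded by the subgroup B of its classification and, when its
    component of degree 1 is scalar, by the corresponding character. *)
Definition node_group (s : KD_node n) : {group G} :=
  match s with
  | NI i => if i == 0 :> nat then 1%G else <[b]>%G
  | NJ k => <[(c ^+ k * b)%g]>%G
  | NK1 | NK2_ _ | NK2 => <[c]>%G
  | NK3 | NK4 => D
  end.

Definition node_char (s : KD_node n) : option (G -> C) :=
  match s with
  | NI i => if i == 0 :> nat then None
            else Some (if i == 1 :> nat then fun=> 1 else refl_sgn)
  | NJ _ | NK2 => None
  | NK1 => Some (rot_char 0)
  | NK2_ j => Some (rot_char j.+1)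
  | NK3 => Some (fun=> 1)
  | NK4 => Some refl_sgn
  end.

Definition node_space s : {vspace galg C G} :=
  if node_char s is Some chi then char_space z chi (node_group s)
  else split_space C z b (node_group s).

Lemma node_groupD s : node_group s \subset D.
Proof.
have sc : <[c]>%g \subset D by rewrite cycle_subG Dc.
case: s => [i|k||j|||] //=; last by rewrite cycle_subG groupM.
by case: ifP => _; rewrite ?sub1G ?cycle_subG.
Qed.

Lemma node_charP s chi : node_char s = Some chi ->
  twisted_char b chi (node_group s).
Proof.
have bb : b \in <[b]>%G := cycle_id b.
case: s => [i|k||j|||] //=.
- case: ifP => // _ [<-]; case: ifP => _; first exact: triv_charP.
  by apply: refl_sgnP; rewrite ?cycle_subG.
- by case=> <-; apply: rot_charP.
- by case=> <-; apply: rot_charP.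
- by case=> <-; apply: triv_charP.
by case=> <-; apply: refl_sgnP.
Qed.

Lemma node_space_graded s : graded_subalgebra z b (node_space s).
Proof.
rewrite /node_space; case E: (node_char s) => [chi|].
  by apply: (char_space_graded zC z2 z1 b2 Dz Db) => //; [apply: node_groupD | apply: node_charP].
by apply: (split_space_graded C zC z2 z1 b2 Dz Db); rewrite ?node_groupD.
Qed.

Lemma node_space_dim s : \dim (node_space s) = node_dim s.
Proof.
have oB := (dih_orders n_prime gen_ab).2.
have oJ k : #|<[(c ^+ k * b)%g]>%G| = 2%N.
  rewrite /= dih_refl_cycle // cards2 eq_sym.
  by case: eqP => // e; have := dih_refl_notin n_prime n_odd gen_ab k; rewrite e group1.
have -> : \dim (node_space s) =
    ((if node_char s is Some _ then 1 else 2) * #|node_group s|)%N.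
  rewrite /node_space; case E: (node_char s) => [chi|].
    by rewrite mul1n (dim_char_space z1 Dz) ?node_groupD.
  by rewrite (dim_split_space C z1 Dz Db) ?node_groupD.
case: s => [i|k||j|||] /=; rewrite ?oJ ?card_dihD -?orderE ?oc ?mul1n //.
by case: ifP => _; rewrite ?cards1 -?orderE ?oB.
Qed.

Lemma node_space_subE s t :
  (node_space s <= node_space t)%VS =
  match node_char s, node_char t with
  | None, Some _ => false
  | Some chi, Some chi' => (node_group s \subset node_group t) &&
      [forall g in node_group s, chi g == chi' g]
  | _, _ => node_group s \subset node_group t
  end.
Proof.
have sD := node_groupD; rewrite /node_space.
case Es: (node_char s) => [chi|]; case Et: (node_char t) => [chi'|].
- by rewrite (@char_sub_char _ _ z b z1 D Dz) ?sD //; apply: node_charP.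
- by rewrite (char_sub_split zC z2 z1 b2 Dz Db) ?sD //; apply: node_charP.
- by rewrite (split_sub_char z1 b2 Dz Db) ?sD.
by rewrite (split_sub_split C zC z2 z1 b2 Dz Db) ?sD.
Qed.

Let bc : (b \in <[c]>%g) = false.
Proof. exact/negbTE/dih_b_notin. Qed.
Let refl_c k : ((c ^+ k * b)%g \in <[c]>%g) = false.
Proof. exact/negbTE/dih_refl_notin. Qed.
Let c_neq1 : (c == 1%g) = false.
Proof. by apply/negbTE; rewrite -order_eq1 oc neq_ltn prime_gt1 ?orbT. Qed.
Let c_refl k : (c \in <[(c ^+ k * b)%g]>%g) = false.
Proof.
rewrite dih_refl_cycle // !inE c_neq1; apply/eqP => e.
by have := refl_c k; rewrite -e cycle_id.
Qed.
Let refl_refl (k k' : 'I_n) : ((c ^+ k * b)%g \in <[(c ^+ k' * b)%g]>%g) = (k == k').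
Proof.
rewrite dih_refl_cycle // !inE (inj_eq (mulIg b)) (dih_cX_eq n_prime gen_ab).
by case: eqP => // e; have := refl_c k; rewrite e group1.
Qed.
Let b_refl (k : 'I_n) : (b \in <[(c ^+ k * b)%g]>%g) = (k == 0 :> nat).
Proof.
have := refl_refl (Ordinal (prime_gt0 n_prime)) k.
by rewrite expg0 mul1g eq_sym => ->.
Qed.
Let sub_D (X : {group G}) : (D \subset X) = (c \in X) && (b \in X).
Proof. by rewrite join_subG !cycle_subG. Qed.

Let neg1 : (-1 == 1 :> C) = false.
Proof. by rewrite -subr_eq0 -opprD oppr_eq0 -mulr2n pnatr_eq0. Qed.

Let rot_char_eq (j j' : nat) : (j < n)%N -> (j' < n)%N ->
  [forall g in <[c]>%g, rot_char j g == rot_char j' g] = (j == j').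
Proof.
move=> jn j'n; apply/forall_inP/eqP => [/(_ c (cycle_id c))|-> //].
rewrite -[c]expg1 !rot_charX !muln1 (eq_prim_root_expr zeta_prim).
by rewrite !modn_small // => /eqP.
Qed.

Let rot_char_triv (j : nat) : (j < n)%N ->
  [forall g in <[c]>%g, rot_char j g == 1] = (j == 0%N).
Proof. by move=> jn; rewrite -(rot_char_eq jn (prime_gt0 n_prime)). Qed.

Let rot_char_sgn (j : nat) : (j < n)%N ->
  [forall g in <[c]>%g, rot_char j g == refl_sgn g] = (j == 0%N).
Proof.
move=> jn; rewrite -rot_char_triv //; apply: eq_forallb_in => g.
by rewrite /refl_sgn => ->.
Qed.

Let sgn_triv (B : {group G}) : b \in B -> [forall g in B, refl_sgn g == 1] = false.
Proof.
by move=> bB; apply/negP => /forall_inP/(_ b bB); rewrite /refl_sgn bc neg1.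
Qed.

Let triv_sgn (B : {group G}) : b \in B -> [forall g in B, 1 == refl_sgn g] = false.
Proof.
by move=> bB; apply/negP => /forall_inP/(_ b bB); rewrite /refl_sgn bc eq_sym neg1.
Qed.

Lemma node_space_sub s t : s <> t ->
  (node_space s <= node_space t)%VS = node_sub s t.
Proof.
move=> st; rewrite node_space_subE.
have one_sub (X : {group G}) : (1%G \subset X) = true by rewrite sub1G.
have c_one : (c \in 1%G) = false by rewrite inE.
have b_one : (b \in 1%G) = false.
  by rewrite inE; apply: contraFF bc => /eqP->; rewrite group1.
have refl_one k : ((c ^+ k * b)%g \in 1%G) = false.
  by rewrite inE; apply: contraFF (refl_c k) => /eqP->; rewrite group1.
have c_b : (c \in <[b]>%g) = false.
  by have := c_refl 0; rewrite expg0 mul1g.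
have bb := cycle_id b; have cc := cycle_id c.
have jn (j : 'I_n.-1) : (j.+1 < n)%N by rewrite -ltn_predRL.
have eq_refl_all (f : G -> C) (X : {group G}) :
  [forall g in X, f g == f g] = true by apply/forall_inP.
have NI_inj (i j : nat) lti ltj :
    NI (@Ordinal 3 i lti) <> NI (@Ordinal 3 j ltj) :> KD_node n -> i <> j.
  by move=> ne e; apply: ne; congr (NI _); apply: val_inj.
have NJ_inj k k' : NJ k <> NJ k' :> KD_node n -> (k == k') = false.
  by move=> ne; apply/eqP => e; apply: ne; rewrite e.
have NK2_inj j j' : NK2_ j <> NK2_ j' :> KD_node n -> (j.+1 == j'.+1) = false.
  by move=> ne; apply/eqP => -[e]; apply: ne; congr (NK2_ _); apply: val_inj.
case: s st => [[[|[|[|//]]] lti]|k||j|||];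
  case: t => [[[|[|[|//]]] lti']|k'||j'|||] st;
  try (by case/NI_inj: st); try move/NJ_inj: st => st; try move/NK2_inj: st => st;
  rewrite /node_char /node_group /node_sub /= ?one_sub ?cycle_subG ?sub_D
    ?bb ?cc ?Db ?Dc ?bc ?refl_c ?c_refl ?b_refl ?refl_refl ?c_one ?b_one
    ?refl_one ?c_b ?rot_char_eq ?rot_char_triv ?rot_char_sgn ?prime_gt0 ?jn
    ?eq_refl_all ?triv_sgn ?sgn_triv ?orbT ?andbF ?st //.
Qed.

(** Running through the subgroups B of D: whenever b is in B, chi(b)^2 = 1; when c is
    in B, chi(c) is an n-th root of unity, and when both are, chi(c) is equal to
    its inverse as well, so it is 1 because n is odd. *)
Lemma node_space_onto S : graded_subalgebra z b S -> S <> 1%VS -> S <> fullv ->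
  exists s, S = node_space s.
Proof.
move=> gS S1 Sf; have cX : forall k, (c ^+ k)%g \in <[c]>%g by move=> k; apply: mem_cycle.
have [PS|PnS] := boolP (helt z 1 1 0 \in S).
  have [B [sBD SE]] := graded_split zC z2 z1 b2 Dz Db gS PS.
  have [EB|[k EB]|EB|EB] := dih_subgroups n_prime n_odd gen_ab sBD; subst B.
  - by exists (NI ord0).
  - by exists (NJ k).
  - by exists NK2.
  by case: Sf; rewrite SE (split_space_full C z1 b2 Dz Db).
have [B [chi [sBD chiP SE]]] := graded_char zC z2 z1 Dz Db gS PnS.
have chi1 := twisted_char1 chiP; have [chiM chiU chib] := chiP.
have chib2 : b \in B -> chi b = 1 \/ chi b = -1.
  move=> bB; have := (chib b bB).2; rewrite conjgE mulKg => /eqP.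
  by rewrite -expr2 sqrf_eq1 => /orP[]/eqP; auto.
have chicX k : c \in B -> chi (c ^+ k)%g = chi c ^+ k.
  move=> cB; elim: k => [|k IHk]; first by rewrite expg0 chi1.
  by rewrite (expgS c) exprS chiM ?IHk //; apply: groupX.
have chicn : c \in B -> chi c ^+ n = 1.
  by move=> cB; rewrite -chicX // cn.
have [EB|[k EB]|EB|EB] := dih_subgroups n_prime n_odd gen_ab sBD; subst B.
- by case: S1; rewrite SE char_space1.
- have k0 : k = 0%N :> nat.
    by apply: (dih_refl_stable n_prime n_odd gen_ab); apply: (chib _ (cycle_id _)).1.
  rewrite k0 expg0 mul1g in SE chib2.
  have SE_b chi' : chi' 1%g = 1 -> chi' b = chi b -> S = char_space z chi' <[b]>.
    move=> chi'1 chi'b; rewrite SE; apply: eq_char_space => g.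
    rewrite /= cycle2g ?(dih_orders n_prime gen_ab).2 // !inE.
    by case/orP => /eqP->; rewrite ?chi1 ?chi'1.
  have [cb|cb] := chib2 (cycle_id b).
    by exists (NI (inord 1)); rewrite /node_space /= inordK //=; apply: SE_b.
  exists (NI (inord 2)); rewrite /node_space /= inordK //=.
  by apply: SE_b; rewrite /refl_sgn ?group1 ?bc ?cb.
- have [j cj] := prim_rootP zeta_prim (chicn (cycle_id c)).
  have SEj : S = char_space z (rot_char j) <[c]>.
    rewrite SE; apply: eq_char_space => _ /cycleP[k ->].
    by rewrite chicX ?cycle_id // rot_charX cj exprM.
  case: j cj SEj => [[|j] jn] /= cj SEj; first by exists NK1.
  have jn' : (j < n.-1)%N by rewrite -ltnS prednK ?prime_gt0.
  by exists (NK2_ (Ordinal jn')).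
have odd_pow (x : C) m : x * x = 1 -> odd m -> x ^+ m = x.
  move=> x2 m_odd; rewrite -(odd_double_half m) m_odd exprS -mul2n exprM.
  by rewrite expr2 x2 expr1n mulr1.
have cc : chi c = 1.
  rewrite -(chicn Dc) odd_pow //.
  have := (chib c Dc).2; rewrite conjgE (dih_bV gen_ab).
  have cbD : (c * b)%g \in D by apply: groupM.
  rewrite (chiM b (c * b)%g) // (chiM c b) //.
  case: (chib2 Db) => ->; rewrite ?mul1r ?mulr1 //.
  by rewrite mulrN1 mulN1r opprK.
have SEe chi' : {in D &, {morph chi' : g h / (g * h)%g >-> g * h}} ->
    (forall k, chi' (c ^+ k)%g = 1) -> chi' b = chi b -> S = char_space z chi' D.
  move=> chi'M chi'c chi'b; rewrite SE; apply: eq_char_space => g /dihDP.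
  case=> // k [|] ->; rewrite ?chiM ?chi'M ?DcX ?Db //;
  by rewrite chicX // cc expr1n chi'c ?mul1r ?chi'b.
have [cb|cb] := chib2 Db; [exists NK3 | exists NK4]; apply: SEe => //.
- by move=> g h _ _; rewrite mulr1.
- by have [] := refl_sgnP Db (subxx D).
- by move=> k; rewrite /refl_sgn cX.
by rewrite cb /refl_sgn bc.
Qed.

Lemma dim_KD : \dim (fullv : {vspace galg C G}) = (4 * n)%N.
Proof.
rewrite -(split_space_full C z1 b2 Dz Db) (dim_split_space C z1 Dz Db) //.
by rewrite (card_dihD n_prime n_odd gen_ab) mulnA.
Qed.

Lemma node_space_proper s : node_space s <> 1%VS /\ node_space s <> fullv.
Proof.
have /andP[d1 df] := node_dim_bounds s (prime_gt1 n_prime).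
split=> e; have := node_space_dim s; rewrite e ?dimv1 ?dim_KD => de.
  by rewrite -de in d1.
by rewrite -de ltnn in df.
Qed.

End Nodes.

(** * Reading off the Hasse diagram *)

Section Hasse.

Variables (C : numClosedFieldType) (n : nat) (G : finGroupType).
Variable Delta : galg C G -> galg C (G * G)%type.
Variable L : KD_node n -> {vspace galg C G}.
Hypothesis LP : forall S, nontrivial_coideal Delta S <-> exists s, S = L s.
Hypothesis L_sub : forall s t, s <> t -> (L s <= L t)%VS = node_sub s t.

Lemma node_sub_asym (s t : KD_node n) : node_sub s t -> node_sub t s = false.
Proof. by case: s => [i|k||j|||]; case: t => [i'|k'||j'|||]. Qed.

Lemma node_sub_neq (s t : KD_node n) : node_sub s t -> s <> t.
Proof. by move=> st ts; have := node_sub_asym st; move: st; rewrite ts => ->. Qed.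

Lemma node_inj : injective L.
Proof.
move=> s t Lst; apply: contrapT => st.
have ts : t <> s by move=> ts; apply: st.
have := node_sub_asym (s := s) (t := t); rewrite -(L_sub st) -(L_sub ts) Lst.
by rewrite subvv => /(_ isT).
Qed.

(** A node that is not marked as minimal lies above I_0 or K_1. *)
Lemma minimal_nodes S :
  minimal_nontrivial_coideal Delta S <-> exists2 s, node_min s & S = L s.
Proof.
split=> [[/LP[s ->] min_s]|[s min_s ->]].
  exists s => //; apply: contraT => not_min.
  have [t st] : exists t, node_sub t s.
    case: s not_min {min_s} => [i|k||j|||] //= _; try by exists NK1.
    by exists (NI ord0).
  have ts := node_sub_neq st.
  case: (ts); apply: node_inj; apply: min_s; last by rewrite L_sub.
  by apply/LP; exists t.
split=> [|T /LP[t ->] tLs]; first by apply/LP; exists s.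
apply: contrapT => ne; have ts : t <> s by move=> e; apply: ne; rewrite e.
by move: tLs; rewrite L_sub //; case: s min_s {ne ts} => [i|k||j|||] //; case: t.
Qed.

(** A node that is not marked as maximal lies below one of K_2, K_3, K_4; the trivial
    subalgebra is not maximal because it lies below K_1. *)
Lemma maximal_nodes S :
  maximal_proper_coideal Delta S <-> exists2 s, node_max s & S = L s.
Proof.
split=> [[coS Sfull max_S]|[s max_s ->]].
  have K1P : nontrivial_coideal Delta (L NK1) by apply/LP; exists NK1.
  have S1 : S <> 1%VS.
    move=> S1; case: K1P => coK K_1 K_f; case: K_1; rewrite -S1.
    by apply: max_S => //; rewrite S1 -memvE; case: coK.
  have /LP[s sE] : nontrivial_coideal Delta S by split.
  rewrite sE in max_S *; exists s => //; apply: contraT => not_max.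
  have [t st] : exists t, node_sub s t.
    case: s not_max {sE max_S} => [[[|[|[|//]]] lti]|k||j|||] //= _;
      by [exists NK2 | exists NK3 | exists NK4].
  have ts := node_sub_neq st.
  have /LP[coT _ T_f] : exists t', L t = L t' by exists t.
  case: (ts); apply: node_inj; rewrite (max_S (L t)) // L_sub //.
have /LP[coS S1 Sf] : exists t, L s = L t by exists s.
split=> // T coT Tf sT.
have T1 : T <> 1%VS.
  move=> T1; case: S1; apply: subv_anti; rewrite -{1}T1 sT -memvE.
  by case: coS.
have /LP[t tE] : nontrivial_coideal Delta T by split.
rewrite tE in sT *; apply: contrapT => ne.
have st : s <> t by move=> e; apply: ne; rewrite e.
by move: sT; rewrite L_sub //; case: s max_s {ne st coS S1 Sf tE} => [i|k||j|||] //; case: t.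
Qed.

End Hasse.

Local Close Scope ring_scope.

Theorem corollary6p8 (R : realType) (n : nat) (a b : 'D_(4 * n)) :
  prime n -> odd n -> dihedral_generators a b ->
  exists L : KD_node n -> {vspace galg R[i] 'D_(4 * n)},
    [/\ injective L,
        (forall S : {vspace galg R[i] 'D_(4 * n)},
           nontrivial_coideal (KD_Delta R[i] a b) S <-> exists s, S = L s),
        (forall s, \dim (L s) = node_dim s),
        (forall s t, s <> t -> (L s <= L t)%VS = node_sub s t) &
        (forall S : {vspace galg R[i] 'D_(4 * n)},
           (minimal_nontrivial_coideal (KD_Delta R[i] a b) S <->
            exists2 s, node_min s & S = L s) /\
           (maximal_proper_coideal (KD_Delta R[i] a b) S <->
            exists2 s, node_max s & S = L s))].
Proof.
move=> n_prime n_odd gen_ab.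
have [zeta zeta_prim] := prime_prim_root R[i] n_prime.
have zC := dih_zC n_prime gen_ab; have z2 := dih_z2 n_prime gen_ab.
have z1 := dih_z_neq1 n_prime gen_ab; have b2 := dih_b2 gen_ab.
pose v := gauge R[i] a b.
have vvs : (v * gstar v = 1)%R by apply: gaugeV.
have vsv : (gstar v * v = 1)%R by apply: gaugeK.
pose L s := (linfun (conjv v) @: node_space a b zeta s)%VS.
have coP S : coideal_subalgebra (KD_Delta R[i] a b) (linfun (conjv v) @: S)%VS
    <-> graded_subalgebra (a ^+ n)%g b S.
  rewrite -(coideal_graded zC z2 z1 b2); apply: coideal_conj => // x.
  exact: KD_Delta_conj.
have ker := lker_conjv vsv.
have L_dim s : \dim (L s) = node_dim s.
  rewrite -(node_space_dim n_prime n_odd gen_ab zeta); apply: limg_dim_eq.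
  by rewrite (eqP ker) capv0.
have L_sub s t : s <> t -> (L s <= L t)%VS = node_sub s t.
  by move=> st; rewrite limg_ker0 // node_space_sub.
have LP S : nontrivial_coideal (KD_Delta R[i] a b) S <-> exists s, S = L s.
  split=> [[]|[s ->]].
    have [T ->] := conjv_img_surj vsv S; move=> /coP gT T1 Tf.
    have [| |s ->] := node_space_onto n_prime n_odd gen_ab zeta_prim gT.
    - by move=> e; apply: T1; rewrite e conjv_img1.
    - by move=> e; apply: Tf; rewrite e conjv_img_full.
    by exists s.
  have [s1 sf] := node_space_proper n_prime n_odd gen_ab zeta s.
  split; first exact/coP/node_space_graded.
    by rewrite -(conjv_img1 vvs) => /(conjv_img_inj vsv).
  by rewrite -(conjv_img_full vsv) => /(conjv_img_inj vsv).
exists L; split=> //; first exact: node_inj L_sub.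
by move=> S; split; [apply: minimal_nodes | apply: maximal_nodes].
Qed.
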